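(* Let $\alpha\ge1$. Suppose there is a polynomial-time $\alpha$-approximation algorithm for the minimum-size $2$-edge connected spanning subgraph problem. Then there is a polynomial-time $\frac{4\alpha}{2\alpha+1}$-approximation algorithm for unweighted $\mathrm{FGC}$.
   Context: The minimum-size $2$-edge connected spanning subgraph problem: given an undirected multigraph $G=(V,E)$ (no self-loops), find a sub-multiset $F\subseteq E$ with $(V,F)$ $2$-edge connected minimizing $|F|$. An instance of unweighted $\mathrm{FGC}$ consists of an undirected connected graph $G=(V,E)$ (multiedges allowed, no self-loops) and a partition $E=\mathscr{S}\,\dot\cup\,\mathscr{U}$ into safe and unsafe edges; $F\subseteq E$ is feasible if for every unsafe edge $e\in F\cap\mathscr{U}$ the graph $(V,F\setminus\{e\})$ is connected; the goal is a feasible $F$ minimizing $|F|$. An $\alpha$-approximation algorithm returns, on every feasible instance, a feasible solution of size at most $\alpha$ times optimal. *)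

(* Defs.v *)
From mathcomp Require Import all_boot all_order all_algebra.
From mathcomp Require Import reals.

Set Implicit Arguments.
Unset Strict Implicit.
Unset Printing Implicit Defensive.

Import Order.TTheory GRing.Theory Num.Theory.

(** * Model of computation

    The WHILE language of N. D. Jones (Computability and Complexity from a
    Programming Perspective, MIT Press 1997), whose data are LISP-style binary
    trees.  Assignments and tests have unit cost: the expressions of a program
    have bounded size, and trees are represented by pointers with sharing, so
    that [Econs], [Ehd] and [Etl] take constant time.  For
    problems with polynomially bounded output, as here, polynomial time in this
    model is polynomial time on Turing machines or random access machines. *)

Inductive tree : Type := Leaf | Node of tree & tree.

Fixpoint tree_size (t : tree) : nat :=
  if t is Node a b then (tree_size a + tree_size b).+1 else 1.

Definition tree_hd (t : tree) : tree := if t is Node a _ then a else Leaf.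
Definition tree_tl (t : tree) : tree := if t is Node _ b then b else Leaf.
Definition is_node (t : tree) : bool := if t is Node _ _ then true else false.

Inductive expr : Type :=
  | Evar of nat
  | Eleaf
  | Econs of expr & expr
  | Ehd of expr
  | Etl of expr.

Inductive cmd : Type :=
  | Cskip
  | Cassign of nat & expr
  | Cseq of cmd & cmd
  | Cif of expr & cmd & cmd
  | Cwhile of expr & cmd.

Definition store := nat -> tree.

Definition update (s : store) (x : nat) (v : tree) : store :=
  fun y => if y == x then v else s y.

Fixpoint eval (s : store) (e : expr) : tree :=
  match e with
  | Evar x => s x
  | Eleaf => Leaf
  | Econs a b => Node (eval s a) (eval s b)
  | Ehd a => tree_hd (eval s a)
  | Etl a => tree_tl (eval s a)
  end.

(* [exec c s t s']: started in [s], [c] halts in [s'] after [t] time units.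
   [Leaf] is false, every [Node] is true. *)
Inductive exec : cmd -> store -> nat -> store -> Prop :=
  | Xskip s : exec Cskip s 1 s
  | Xassign s x e : exec (Cassign x e) s 1 (update s x (eval s e))
  | Xseq c1 c2 s1 s2 s3 t1 t2 :
      exec c1 s1 t1 s2 -> exec c2 s2 t2 s3 ->
      exec (Cseq c1 c2) s1 (t1 + t2) s3
  | Xif_true e c1 c2 s s' t :
      is_node (eval s e) -> exec c1 s t s' -> exec (Cif e c1 c2) s t.+1 s'
  | Xif_false e c1 c2 s s' t :
      ~~ is_node (eval s e) -> exec c2 s t s' -> exec (Cif e c1 c2) s t.+1 s'
  | Xwhile_stop e c s : ~~ is_node (eval s e) -> exec (Cwhile e c) s 1 s
  | Xwhile_step e c s1 s2 s3 t1 t2 :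
      is_node (eval s1 e) -> exec c s1 t1 s2 -> exec (Cwhile e c) s2 t2 s3 ->
      exec (Cwhile e c) s1 (t1 + t2).+1 s3.

(* The input is passed in variable 0, where the output is found at the end. *)
Definition init_store (input : tree) : store :=
  fun x => if x == 0 then input else Leaf.

(** * Encodings *)

(* Numbers are in unary; they only name vertices, so this is polynomially
   equivalent to binary. *)
Definition enc_nat (n : nat) : tree := iter n (Node Leaf) Leaf.

Definition enc_bool (b : bool) : tree := if b then Node Leaf Leaf else Leaf.

Definition enc_seq (s : seq tree) : tree := foldr Node Leaf s.

(* Characteristic bit vector. *)
Definition enc_set (m : nat) (F : {set 'I_m}) : tree :=
  enc_seq [seq enc_bool (e \in F) | e <- enum 'I_m].

(** * Optimization over edge subsets *)

(* The ground set of [x] is ['I_(ground x)]; the size of a solution, to be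
   minimized, is its cardinality. *)
Record min_problem : Type := MinProblem {
  instance : Type;
  ground : instance -> nat;
  feasible : forall x : instance, pred {set 'I_(ground x)};
  encode : instance -> tree
}.

Definition feasible_instance (P : min_problem) (x : instance P) : Prop :=
  exists F : {set 'I_(ground x)}, feasible F.

Definition is_opt (P : min_problem) (x : instance P) (k : nat) : Prop :=
  (exists2 F : {set 'I_(ground x)}, feasible F & #|F| = k) /\
  (forall F : {set 'I_(ground x)}, feasible F -> k <= #|F|).

Definition approx_solution (R : realType) (P : min_problem) (alpha : R)
    (x : instance P) (F : {set 'I_(ground x)}) : Prop :=
  feasible F /\ forall k : nat, is_opt x k -> (#|F|%:R <= alpha * k%:R)%R.

(* The time bound is required on all instances, the approximation guarantee
   on those that have a feasible solution. *)
Definition has_polytime_approx (R : realType) (P : min_problem) (alpha : R) :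
    Prop :=
  exists (c : cmd) (a d : nat), forall x : instance P,
  exists (t : nat) (s : store),
    [/\ exec c (init_store (encode x)) t s,
        t <= a * tree_size (encode x) ^ d + a
      & feasible_instance x ->
        exists2 F : {set 'I_(ground x)},
          s 0 = enc_set F & approx_solution alpha F].

(** * Multigraphs *)

(* Edges are numbered, so parallel edges are distinct elements of ['I_ne] and
   sub-multisets of the edge multiset are sets of edge numbers.  The order of
   the two ends of an edge is irrelevant, see [adj]. *)
Record multigraph : Type := Multigraph {
  nv : nat;
  ne : nat;
  ends : 'I_ne -> 'I_nv * 'I_nv;
  nv_gt0 : 0 < nv;
  no_loop : forall e : 'I_ne, (ends e).1 != (ends e).2
}.

Definition adj (G : multigraph) (F : {set 'I_(ne G)}) : rel 'I_(nv G) :=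
  fun u v => [exists e in F, (ends e == (u, v)) || (ends e == (v, u))].

Definition connected (G : multigraph) (F : {set 'I_(ne G)}) : bool :=
  [forall u, forall v, connect (adj F) u v].

Definition two_edge_connected (G : multigraph) (F : {set 'I_(ne G)}) : bool :=
  connected F && [forall e in F, connected (F :\ e)].

Definition enc_graph (G : multigraph) : tree :=
  Node (enc_nat (nv G))
       (enc_seq [seq Node (enc_nat (ends e).1) (enc_nat (ends e).2)
                | e <- enum 'I_(ne G)]).

Definition two_ecss : min_problem :=
  @MinProblem multigraph ne two_edge_connected enc_graph.

(** * Flexible graph connectivity *)

(* The unsafe edges are those outside [safe]. *)
Record fgc_instance : Type := FGCInstance {
  fgc_graph : multigraph;
  safe : {set 'I_(ne fgc_graph)};
  fgc_connected : connected [set: 'I_(ne fgc_graph)]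
}.

Definition unsafe (I : fgc_instance) : {set 'I_(ne (fgc_graph I))} :=
  ~: safe I.

(* Connectedness of [F] itself has to be asked for: it does not follow from
   the second conjunct when [F] has no unsafe edge. *)
Definition fgc_feasible (I : fgc_instance) (F : {set 'I_(ne (fgc_graph I))}) :
    bool :=
  connected F && [forall e in F :&: unsafe I, connected (F :\ e)].

Definition enc_fgc (I : fgc_instance) : tree :=
  Node (enc_graph (fgc_graph I)) (enc_set (safe I)).

Definition fgc : min_problem :=
  @MinProblem fgc_instance (fun I => ne (fgc_graph I)) fgc_feasible enc_fgc.

(* Main.v *)
Require Import Defs.
From mathcomp Require Import all_boot all_order all_algebra.
From mathcomp Require Import reals.
From mathcomp Require Import zify lra.

(** Return the smaller of two solutions.  Let [X] be an optimal solution and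
    [s] its number of safe edges.

    The first solution comes from a 2-edge connected subgraph of the graph in
    which every safe edge is doubled.  There, [X] together with the copies of
    its safe edges is 2-edge connected, so this costs at most
    [alpha * (#|X| + s)].

    The second grows a path of components, whose end component is extended by
    a safe edge if possible, and otherwise by an unsafe edge to a new component;
    when no edge leads out of the path, the edge from the end component back to
    the earliest possible component closes a cycle, which is contracted.  The
    cut around the end component then has no safe edge, so it contains at least
    two unsafe edges of [X], and these become inner edges of the contracted
    component: the cuts of different contractions are disjoint in [X].  With
    [q] contractions the solution has [n - 1 + q] edges, where [n - 1 <= #|X|]
    and [2 * q <= #|X| - s].

    If [a] and [b] are the two sizes, then [a + 2 * alpha * b <= 4 * alpha * #|X|],
    which bounds [(2 * alpha + 1) * minn a b].

    For running times, functions on trees are composed from polynomial-time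
    combinators; every loop is cut off after a number of rounds that depends on
    the instance only. *)

Set Implicit Arguments.
Unset Strict Implicit.
Unset Printing Implicit Defensive.
Import Order.TTheory GRing.Theory Num.Theory.

(** * Polynomial-time functions on trees *)

Fixpoint expr_bound (e : expr) : nat :=
  match e with
  | Evar x => x.+1
  | Eleaf => 0
  | Econs a b => maxn (expr_bound a) (expr_bound b)
  | Ehd a | Etl a => expr_bound a
  end.

Fixpoint cmd_bound (c : cmd) : nat :=
  match c with
  | Cskip => 0
  | Cassign x e => maxn x.+1 (expr_bound e)
  | Cseq c1 c2 => maxn (cmd_bound c1) (cmd_bound c2)
  | Cif e c1 c2 => maxn (expr_bound e) (maxn (cmd_bound c1) (cmd_bound c2))
  | Cwhile e c => maxn (expr_bound e) (cmd_bound c)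
  end.

Definition agree (N : nat) (s s' : store) : Prop :=
  forall y, y < N -> s y = s' y.

Lemma eval_agree N s s' e :
  agree N s s' -> expr_bound e <= N -> eval s e = eval s' e.
Proof.
move=> ag; elim: e => [x||a IHa b IHb|a IHa|a IHa] //=; first exact: ag.
- by rewrite geq_max => /andP[aN bN]; rewrite IHa ?IHb.
- by move=> aN; rewrite IHa.
- by move=> aN; rewrite IHa.
Qed.

(** Variables from [cmd_bound c] on are never assigned, so values can be saved there across a call
    of [c]. *)
Lemma exec_frame c s t s' :
  exec c s t s' -> forall y, cmd_bound c <= y -> s' y = s y.
Proof.
elim=> {c s t s'} //=.
- move=> s x e y; rewrite geq_max /update => /andP[xy _].
  by case: eqP xy => // ->; rewrite ltnn.
- move=> c1 c2 s1 s2 s3 t1 t2 _ IH1 _ IH2 y.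
  by rewrite geq_max => /andP[h1 h2]; rewrite IH2 ?IH1.
- by move=> e c1 c2 s s' t _ _ IH y; rewrite !geq_max => /and3P[_ h _]; exact: IH.
- by move=> e c1 c2 s s' t _ _ IH y; rewrite !geq_max => /and3P[_ _ h]; exact: IH.
move=> e c s1 s2 s3 t1 t2 _ _ IH1 _ IH2 y h; rewrite IH2 // IH1 //.
by move: h; rewrite geq_max => /andP[].
Qed.

(** The given program for 2-edge connected subgraphs is specified on [init_store] alone; this
    transfers its run to a store that also holds the saved instance in a high variable. *)
Lemma exec_agree c s t s' :
  exec c s t s' -> forall N s1, cmd_bound c <= N -> agree N s s1 ->
  exists2 s1', exec c s1 t s1' & agree N s' s1'.
Proof.
elim=> {c s t s'} /=.
- by move=> s N s1 _ ag; exists s1 => //; constructor.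
- move=> s x e N s1; rewrite geq_max => /andP[_ eN] ag.
  exists (update s1 x (eval s1 e)); first by constructor.
  by move=> y yN; rewrite /update (eval_agree ag eN); case: ifP => // _; apply: ag.
- move=> c1 c2 s1 s2 s3 t1 t2 _ IH1 _ IH2 N s; rewrite geq_max => /andP[h1 h2] ag.
  have [s' x1 /(IH2 _ _ h2)[s'' x2 ag2]] := IH1 _ _ h1 ag.
  by exists s'' => //; apply: Xseq x1 x2.
- move=> e c1 c2 s s' t ne _ IH N s1; rewrite !geq_max => /and3P[he h1 _] ag.
  have [s'' x1 ag1] := IH _ _ h1 ag.
  by exists s'' => //; apply: Xif_true x1; rewrite -(eval_agree ag he).
- move=> e c1 c2 s s' t ne _ IH N s1; rewrite !geq_max => /and3P[he _ h1] ag.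
  have [s'' x1 ag1] := IH _ _ h1 ag.
  by exists s'' => //; apply: Xif_false x1; rewrite -(eval_agree ag he).
- move=> e c s ne N s1; rewrite geq_max => /andP[he _] ag.
  by exists s1 => //; apply: Xwhile_stop; rewrite -(eval_agree ag he).
move=> e c s1 s2 s3 t1 t2 ne _ IH1 _ IH2 N s hh ag.
have /andP[he hc] : (expr_bound e <= N) && (cmd_bound c <= N) by rewrite -geq_max.
have [s' x1 /(IH2 _ _ hh)[s'' x2 ag2]] := IH1 _ _ hc ag.
by exists s'' => //; apply: Xwhile_step x1 x2; rewrite -(eval_agree ag he).
Qed.

(** * Total correctness with time bounds *)

Definition runs (c : cmd) (s : store) (b : nat) (Q : store -> Prop) : Prop :=
  exists t s', [/\ exec c s t s', t <= b & Q s'].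

Lemma runs_weaken c s b b' (Q Q' : store -> Prop) :
  runs c s b Q -> b <= b' -> (forall s', Q s' -> Q' s') -> runs c s b' Q'.
Proof.
move=> [t [s' [x le_t q]]] le_b QQ'; exists t, s'; split=> //.
- exact: leq_trans le_b.
- exact: QQ'.
Qed.

Lemma runs_frame c s b (Q : store -> Prop) :
  runs c s b Q ->
  runs c s b (fun s' => Q s' /\ forall y, cmd_bound c <= y -> s' y = s y).
Proof.
by move=> [t [s' [x le_t q]]]; exists t, s'; split=> //; split=> //; exact: exec_frame x.
Qed.

Lemma runs_skip s (Q : store -> Prop) : Q s -> runs Cskip s 1 Q.
Proof. by move=> q; exists 1, s; split=> //; constructor. Qed.

Lemma runs_assign x e s (Q : store -> Prop) :
  Q (update s x (eval s e)) -> runs (Cassign x e) s 1 Q.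
Proof. by move=> q; exists 1, (update s x (eval s e)); split=> //; constructor. Qed.

(** The run of [c2] is nested in the postcondition of [c1], so that programs are verified by
    symbolic execution from front to back. *)
Lemma runs_seq b1 b2 c1 c2 s (Q : store -> Prop) :
  runs c1 s b1 (fun s1 => runs c2 s1 b2 Q) -> runs (Cseq c1 c2) s (b1 + b2) Q.
Proof.
move=> [t1 [s1 [x1 l1 [t2 [s2 [x2 l2 q]]]]]]; exists (t1 + t2), s2; split=> //.
- exact: Xseq x1 x2.
- exact: leq_add.
Qed.

Lemma runs_if e c1 c2 s b (Q : store -> Prop) :
  runs (if is_node (eval s e) then c1 else c2) s b Q -> runs (Cif e c1 c2) s b.+1 Q.
Proof.
case: ifPn => h [t [s' [x l q]]]; exists t.+1, s'; split=> //.
- exact: Xif_true x.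
- exact: Xif_false x.
Qed.

Lemma runs_while_stop e c s (Q : store -> Prop) :
  ~~ is_node (eval s e) -> Q s -> runs (Cwhile e c) s 1 Q.
Proof. by move=> h q; exists 1, s; split=> //; constructor. Qed.

Lemma runs_while_step b1 b2 e c s (Q : store -> Prop) :
  is_node (eval s e) -> runs c s b1 (fun s1 => runs (Cwhile e c) s1 b2 Q) ->
  runs (Cwhile e c) s (b1 + b2).+1 Q.
Proof.
move=> h [t1 [s1 [x1 l1 [t2 [s2 [x2 l2 q]]]]]]; exists (t1 + t2).+1, s2; split=> //.
- exact: Xwhile_step x1 x2.
- by rewrite ltnS; exact: leq_add.
Qed.

(** * Bounds polynomial in the size of a tree *)

Lemma tree_size_gt0 t : 0 < tree_size t.
Proof. by case: t. Qed.

Lemma poly_add n a b d e : 0 < n -> a * n ^ d + b * n ^ e <= (a + b) * n ^ (d + e).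
Proof.
move=> n0; rewrite mulnDl expnD; apply: leq_add; rewrite leq_mul2l.
- by rewrite leq_pmulr ?orbT // expn_gt0 n0.
- by rewrite leq_pmull ?orbT // expn_gt0 n0.
Qed.

Definition poly_le (f : tree -> nat) : Prop :=
  exists a d, forall k, f k <= a * tree_size k ^ d.

Lemma poly_le_cst n : poly_le (fun _ => n).
Proof. by exists n, 0 => k; rewrite muln1. Qed.

Lemma poly_leD f g : poly_le f -> poly_le g -> poly_le (fun k => f k + g k).
Proof.
move=> [a [d hf]] [b [e hg]]; exists (a + b), (d + e) => k.
exact: leq_trans (leq_add (hf k) (hg k)) (poly_add _ _ _ _ (tree_size_gt0 k)).
Qed.

Lemma poly_leM f g : poly_le f -> poly_le g -> poly_le (fun k => f k * g k).
Proof.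
move=> [a [d hf]] [b [e hg]]; exists (a * b), (d + e) => k.
by rewrite expnD mulnACA leq_mul.
Qed.

Lemma poly_leS f : poly_le f -> poly_le (fun k => (f k).+1).
Proof.
move=> hf; have [a [d h]] := poly_leD (poly_le_cst 1) hf.
by exists a, d => k; apply: leq_trans (h k); rewrite add1n.
Qed.

Lemma poly_le_trans f g : (forall k, f k <= g k) -> poly_le g -> poly_le f.
Proof.
by move=> fg [a [d h]]; exists a, d => k; apply: leq_trans (fg k) (h k).
Qed.

Lemma poly_le_exp f d : poly_le f -> poly_le (fun k => f k ^ d).
Proof.
move=> pf; elim: d => [|d IH]; first by apply: poly_le_trans (poly_le_cst 1).
apply: poly_le_trans (poly_leM pf IH) => k.
by rewrite expnS.
Qed.

Fixpoint tree_list (t : tree) : seq tree :=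
  if t is Node a b then a :: tree_list b else [::].

(** On an encoded instance, [tree_hd k] read as a list is the vertex number followed by the edges,
    so [fuel k] is the number of edges plus one. *)
Definition fuel (k : tree) : nat := size (tree_list (tree_hd k)).

(* All loops are cut off after [fuel k] rounds, so that no bound on the lists
   they run over is needed for their running time. *)
Definition lst (k l : tree) : seq tree := take (fuel k) (tree_list l).

Lemma fuel_le k : fuel k <= tree_size k.
Proof.
have h t : size (tree_list t) <= tree_size t.
  by elim: t => //= a _ b IH; rewrite ltnS (leq_trans IH) // leq_addl.
by case: k => //= a b; rewrite /fuel /= (leq_trans (h a)) // -addnS leq_addr.
Qed.

(* [k] is the problem instance, which alone bounds the running time; [x] holds
   intermediate results. *)
Definition ptime (f : tree -> tree -> tree) : Prop :=
  exists c b, poly_le b /\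
    forall k s, s 0 = k ->
    runs c s (b k) (fun s' => s' 0 = k /\ s' 1 = f k (s 1)).

Lemma ptime_arg : ptime (fun k x => x).
Proof.
exists Cskip, (fun _ => 1); split; first exact: poly_le_cst.
by move=> k s sk; apply: runs_skip.
Qed.

Lemma ptime_key : ptime (fun k x => k).
Proof.
exists (Cassign 1 (Evar 0)), (fun _ => 1); split; first exact: poly_le_cst.
by move=> k s sk; apply: runs_assign; rewrite /update /= sk.
Qed.

Lemma ptime_leaf : ptime (fun k x => Leaf).
Proof.
exists (Cassign 1 Eleaf), (fun _ => 1); split; first exact: poly_le_cst.
by move=> k s sk; apply: runs_assign; rewrite /update /= sk.
Qed.

Lemma ptime_comp f g :
  ptime f -> ptime g -> ptime (fun k x => f k (g k x)).
Proof.
move=> [cf [bf [pf hf]]] [cg [bg [pg hg]]].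
exists (Cseq cg cf), (fun k => bg k + bf k); split; first exact: poly_leD.
move=> k s sk; apply: runs_seq; apply: runs_weaken (hg _ _ sk) _ _ => // s1 [s10 s11].
by rewrite -s11; exact: hf.
Qed.

Lemma ptime_hd f : ptime f -> ptime (fun k x => tree_hd (f k x)).
Proof.
move=> hf; apply: ptime_comp (fun k => tree_hd) f _ hf.
exists (Cassign 1 (Ehd (Evar 1))), (fun _ => 1); split; first exact: poly_le_cst.
by move=> k s sk; apply: runs_assign; rewrite /update /= sk.
Qed.

Lemma ptime_tl f : ptime f -> ptime (fun k x => tree_tl (f k x)).
Proof.
move=> hf; apply: ptime_comp (fun k => tree_tl) f _ hf.
exists (Cassign 1 (Etl (Evar 1))), (fun _ => 1); split; first exact: poly_le_cst.
by move=> k s sk; apply: runs_assign; rewrite /update /= sk.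
Qed.

Lemma update_eq s x v : update s x v x = v.
Proof. by rewrite /update eqxx. Qed.

Lemma update_ne s x v y : y != x -> update s x v y = s y.
Proof. by rewrite /update => /negPf ->. Qed.

Lemma ptime_node f g :
  ptime f -> ptime g -> ptime (fun k x => Node (f k x) (g k x)).
Proof.
move=> [cf [bf [pf hf]]] [cg [bg [pg hg]]].
set N := maxn 2 (maxn (cmd_bound cf) (cmd_bound cg)).
have N2 : 2 <= N by rewrite /N; lia.
have Nf : cmd_bound cf <= N by rewrite /N; lia.
have Ng : cmd_bound cg <= N by rewrite /N; lia.
exists (Cseq (Cassign N (Evar 1)) (Cseq cf (Cseq (Cassign N.+1 (Evar 1))
  (Cseq (Cassign 1 (Evar N)) (Cseq cg (Cassign 1 (Econs (Evar N.+1) (Evar 1)))))))).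
exists (fun k => 1 + (bf k + (1 + (1 + (bg k + 1))))); split.
  by do ![apply: poly_leD | apply: poly_le_cst].
move=> k s sk.
apply: runs_seq; apply: runs_assign; apply: runs_seq.
apply: runs_weaken (runs_frame (hf k _ _)) _ _ => //; first by rewrite update_ne //; lia.
move=> s1 [[s10 s11] fr1].
apply: runs_seq; apply: runs_assign; apply: runs_seq; apply: runs_assign => /=.
apply: runs_seq.
apply: runs_weaken (runs_frame (hg k _ _)) _ _ => //.
move=> s2 [[s20 s21] fr2]; apply: runs_assign => /=.
rewrite update_eq update_ne // s20; split=> //; congr Node.
- rewrite fr2; last by lia.
  rewrite update_ne; last by lia.
  by rewrite update_eq s11 /= update_ne //; lia.
- rewrite s21 update_eq update_ne; last by lia.
  by rewrite fr1 // update_eq.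
Qed.

Lemma ptime_if c f g :
  ptime c -> ptime f -> ptime g ->
  ptime (fun k x => if is_node (c k x) then f k x else g k x).
Proof.
move=> [cc [bc [pc hc]]] [cf [bf [pf hf]]] [cg [bg [pg hg]]].
set N := maxn 2 (cmd_bound cc).
have N2 : 2 <= N by rewrite /N; lia.
have Nc : cmd_bound cc <= N by rewrite /N; lia.
exists (Cseq (Cassign N (Evar 1)) (Cseq cc (Cseq (Cassign N.+1 (Evar 1))
  (Cseq (Cassign 1 (Evar N)) (Cif (Evar N.+1) cf cg))))).
exists (fun k => 1 + (bc k + (1 + (1 + (bf k + bg k).+1)))); split.
  by do ![apply: poly_leD | apply: poly_leS | apply: poly_le_cst].
move=> k s sk.
apply: runs_seq; apply: runs_assign; apply: runs_seq.
apply: runs_weaken (runs_frame (hc k _ _)) _ _ => //; first by rewrite update_ne //; lia.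
move=> s1 [[s10 s11] fr1].
apply: runs_seq; apply: runs_assign; apply: runs_seq; apply: runs_assign => /=.
apply: runs_if => /=; rewrite update_ne; last by lia.
rewrite update_eq s11 update_ne /=; last by lia.
set s2 := update _ 1 _.
have s21 : s2 1 = s 1.
  by rewrite /s2 update_eq update_ne ?fr1 ?update_eq //; lia.
have s20 : s2 0 = k by rewrite /s2 !update_ne //; lia.
case: ifP => _.
- by apply: runs_weaken (hf k _ _) _ _ => //; rewrite ?s21 ?leq_addr.
- by apply: runs_weaken (hg k _ _) _ _ => //; rewrite ?s21 ?leq_addl.
Qed.

(** The loop keeps the argument in [N], the remaining list in [N.+1], the accumulator in [N.+2] and
    a countdown in [N.+3]; it runs [fuel k] rounds and idles once the list is exhausted. The time
    bound of a round depends on [k] only, not on the size of the accumulator, so the total is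
    polynomial in the size of [k]. *)
Lemma ptime_foldl step init l :
  ptime (fun k y => step k (tree_tl (tree_tl y)) (tree_hd y) (tree_hd (tree_tl y))) ->
  ptime init -> ptime l ->
  ptime (fun k x => foldl (step k x) (init k x) (lst k (l k x))).
Proof.
move=> [cs [bs [ps hs]]] [ci [bi [pi hi]]] [cl [bl [pl hl]]].
set N := maxn 2 (maxn (cmd_bound cs) (maxn (cmd_bound ci) (cmd_bound cl))).
have N2 : 2 <= N by rewrite /N; lia.
have Ns : cmd_bound cs <= N by rewrite /N; lia.
have Ni : cmd_bound ci <= N by rewrite /N; lia.
have Nl : cmd_bound cl <= N by rewrite /N; lia.
pose body := Cseq (Cif (Evar N.+1)
    (Cseq (Cassign 1 (Econs (Evar N.+2) (Econs (Ehd (Evar N.+1)) (Evar N))))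
      (Cseq cs (Cseq (Cassign N.+2 (Evar 1)) (Cassign N.+1 (Etl (Evar N.+1))))))
    Cskip) (Cassign N.+3 (Etl (Evar N.+3))).
pose bb k := (1 + (bs k + (1 + 1))).+1 + 1.
exists (Cseq (Cassign N (Evar 1)) (Cseq cl (Cseq (Cassign N.+1 (Evar 1))
  (Cseq (Cassign 1 (Evar N)) (Cseq ci (Cseq (Cassign N.+2 (Evar 1))
  (Cseq (Cassign N.+3 (Ehd (Evar 0))) (Cseq (Cwhile (Evar N.+3) body)
  (Cassign 1 (Evar N.+2)))))))))).
exists (fun k => 1 + (bl k + (1 + (1 + (bi k + (1 + (1 + (((fuel k) * (bb k).+1).+1 + 1)))))))).
split.
  do ![apply: poly_leD | apply: poly_leS | apply: poly_leM | apply: poly_le_cst | by []].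
  by exists 1, 1 => k; rewrite mul1n expn1 fuel_le.
move=> k s sk.
apply: runs_seq; apply: runs_assign; apply: runs_seq.
apply: runs_weaken (runs_frame (hl k _ _)) _ _ => //; first by rewrite update_ne //; lia.
move=> s1 [[s10 s11] fr1].
apply: runs_seq; apply: runs_assign; apply: runs_seq; apply: runs_assign => /=.
apply: runs_seq.
apply: runs_weaken (runs_frame (hi k _ _)) _ _ => //.
move=> s2 [[s20 s21] fr2].
apply: runs_seq; apply: runs_assign; apply: runs_seq; apply: runs_assign => /=.
rewrite update_ne; last by lia.
apply: runs_seq; set s3 := update _ N.+3 _.
have e0 : s3 0 = k by rewrite /s3 !update_ne //; lia.
have eN : s3 N = s 1.
  rewrite /s3 !update_ne ?fr2 ?update_ne ?fr1 ?update_eq //; lia.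
have eN1 : s3 N.+1 = l k (s 1).
  rewrite /s3 !update_ne ?fr2; try lia.
  rewrite update_ne ?update_eq ?s11 /=; last by lia.
  by rewrite update_ne //; lia.
have eN2 : s3 N.+2 = init k (s 1).
  rewrite /s3 update_ne ?update_eq; last by lia.
  rewrite s21 update_eq update_ne ?fr1 ?update_eq //; lia.
have eN3 : s3 N.+3 = tree_hd k by rewrite /s3 update_eq s20.
rewrite /lst /fuel -eN1 -eN2 -eN3; move: (s 1) eN => x.
clearbody s3; clear s1 s2 s10 s11 s20 s21 fr1 fr2 eN1 eN2 eN3 s sk.
have [f ef] : exists f, f = s3 N.+3 by eexists.
rewrite -ef.
elim: f s3 e0 ef => [|? _ f IH] s e0 ef eN /=.
  apply: runs_while_stop => /=; first by rewrite -ef.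
  by apply: runs_assign; rewrite update_eq update_ne //= take0.
apply: (@runs_weaken _ _ (bb k + (size (tree_list f) * (bb k).+1).+1).+1 _
   (fun s1 => runs (Cassign 1 (Evar N.+2)) s1 1 _)); [|by lia|by move=> s1 h; exact: h].
apply: runs_while_step; first by rewrite /= -ef.
apply: runs_seq; apply: runs_if => /=.
case El: (s N.+1) => [|y l'] /=.
  apply: runs_weaken (runs_skip _) _ _ => [|//|s' h]; last exact: h.
  apply: runs_assign; rewrite /= -ef /=.
  apply: runs_weaken (IH _ _ _ _) _ _ => [|||//|s' h]; last first.
  - move: h; rewrite !update_ne ?El //=; lia.
  - by rewrite update_ne //; lia.
  - by rewrite update_eq.
  - by rewrite update_ne //; lia.
apply: runs_seq; apply: runs_assign; apply: runs_seq => /=; rewrite El /=.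
apply: runs_weaken (runs_frame (hs k _ _)) _ _ => //.
move=> s1 [[s10 s11] fr1]; rewrite update_eq /= in s11.
have fr y' : N <= y' -> s1 y' = s y'.
  by move=> h; rewrite fr1 ?update_ne //; lia.
apply: runs_seq; apply: runs_assign; apply: runs_assign; apply: runs_assign => /=.
have n12 : N.+1 != N.+2 by lia.
rewrite (@update_ne _ _ _ N.+1) // (fr N.+1); last by lia.
rewrite El /= (@update_ne _ N.+1 _ N.+3); last by lia.
rewrite (@update_ne _ N.+2 _ N.+3) ?(fr N.+3); try lia.
rewrite -ef /=.
apply: runs_weaken (IH _ _ _ _) _ _ => [|||//|s' h]; last first.
- move: h; rewrite (@update_ne _ N.+3) ?update_eq; last by lia.
  rewrite (@update_ne _ N.+3) ?update_eq; last by lia.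
  rewrite update_ne; last by lia.
  by rewrite update_eq s11 eN.
- by rewrite !update_ne ?fr //; lia.
- by rewrite update_eq.
- by rewrite !update_ne //; lia.
Qed.

(** * Connectivity of multigraphs *)

Definition joins (G : multigraph) (e : 'I_(ne G)) (u v : 'I_(nv G)) : bool :=
  (ends e == (u, v)) || (ends e == (v, u)).

Section Connectivity.

Variable G : multigraph.
Implicit Types (e : 'I_(ne G)) (u v : 'I_(nv G)) (F : {set 'I_(ne G)}).

Lemma joinsC e u v : joins e u v = joins e v u.
Proof. by rewrite /joins orbC. Qed.

Lemma joins_ends e : joins e (ends e).1 (ends e).2.
Proof. by rewrite /joins -surjective_pairing eqxx. Qed.

Lemma joins_eq e u v u' v' :
  joins e u v -> joins e u' v' -> (u' = u /\ v' = v) \/ (u' = v /\ v' = u).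
Proof.
by move=> /orP[]/eqP E1 /orP[]/eqP; rewrite E1 => -[-> ->]; [left|right|right|left].
Qed.

Lemma adjP F u v : reflect (exists2 e, e \in F & joins e u v) (adj F u v).
Proof. by apply: (iffP exists_inP) => -[e eF h]; exists e. Qed.

Lemma connect_adj_sym F : connect_sym (adj F).
Proof.
apply: sym_connect_sym => u v.
by apply/adjP/adjP => -[e eF h]; exists e => //; rewrite joinsC.
Qed.

Lemma connect_edge F e u v : e \in F -> joins e u v -> connect (adj F) u v.
Proof. by move=> eF h; apply/connect1/adjP; exists e. Qed.

Lemma connect_adj_sub F F' u v :
  F \subset F' -> connect (adj F) u v -> connect (adj F') u v.
Proof.
move=> /subsetP sub; apply: connect_sub => x y /adjP[e eF h].
by apply: (@connect_edge _ e) => //; apply: sub.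
Qed.

Lemma connectedP F :
  reflect (forall u v, connect (adj F) u v) (connected F).
Proof. by apply: (iffP forallP) => [h u v|h u]; [apply/(forallP (h u))|apply/forallP]. Qed.

(** If no edge of [F] left [W], then [W] would be closed under [adj F] and could not separate
    connected vertices. The cut arguments below go through this lemma. *)
Lemma connected_cut F (W : pred 'I_(nv G)) u v :
  connected F -> W u -> ~~ W v ->
  exists e x y, [/\ e \in F, joins e x y, W x & ~~ W y].
Proof.
move=> /connectedP cF Wu nWv.
case: (boolP [exists e in F, W (ends e).1 != W (ends e).2]).
  move=> /exists_inP[e eF]; case E1: (W (ends e).1); case E2: (W (ends e).2) => // _.
  - by exists e, (ends e).1, (ends e).2; rewrite E1 E2 joins_ends.
  - by exists e, (ends e).2, (ends e).1; rewrite E1 E2 joinsC joins_ends.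
rewrite negb_exists => /forallP h.
have cl : closed (adj F) W.
  move=> x y /adjP[e eF jxy]; have := h e; rewrite eF /= negbK => /eqP.
  by case/orP: jxy => /eqP -> /=.
by have := closed_connect cl (cF u v); rewrite !unfold_in Wu (negPf nWv).
Qed.

(** A proper nonempty vertex set has an edge leaving it; adding the far end makes this edge a new
    inner edge, so the set grown to [k + 1] vertices has at least [k] inner edges. *)
Lemma connected_card F : connected F -> nv G <= #|F|.+1.
Proof.
move=> cF; pose inner (W : {set 'I_(nv G)}) :=
  [set e in F | ((ends e).1 \in W) && ((ends e).2 \in W)].
have grow k : k < nv G -> exists2 W : {set 'I_(nv G)}, #|W| = k.+1 & k <= #|inner W|.
  elim: k => [|k IH] kn; first by exists [set Ordinal (nv_gt0 G)]; rewrite ?cards1.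
  have [W cW iW] := IH (ltnW kn).
  have [u uW] : exists u, u \in W by apply/card_gt0P; rewrite cW.
  have [v nvW] : exists v, v \notin W.
    have /card_gt0P[v] : 0 < #|~: W| by have := cardsC W; rewrite card_ord; lia.
    by rewrite inE; exists v.
  have [e [x [y [eF jxy xW' yW']]]] := connected_cut cF uW nvW.
  have xW : x \in W := xW'; have yW : y \notin W := yW'.
  exists (y |: W); first by rewrite cardsU1 yW cW.
  have ne : e \notin inner W.
    by rewrite inE eF; case/orP: jxy => /eqP -> /=; rewrite (negPf yW) ?andbF.
  have := subset_leq_card (_ : e |: inner W \subset inner (y |: W)).
  rewrite cardsU1 ne => h; apply: leq_trans (h _); first by rewrite add1n ltnS.
  apply/subsetP => e'; rewrite !inE => /predU1P[->|/and3P[-> -> ->]]; last by rewrite !orbT.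
  by rewrite eF; case/orP: jxy => /eqP -> /=; rewrite eqxx xW ?orbT.
have n0 := nv_gt0 G.
have [|W cW iW] := grow (nv G).-1; first by lia.
have := subset_leq_card (_ : inner W \subset F).
by move=> /(_ _)/(leq_trans iW) h; have := h _; rewrite -ltnS prednK //; apply; apply/subsetP => e; rewrite inE => /andP[].
Qed.

End Connectivity.

(** * The path-based algorithm *)

Section PathBased.

Variable I : fgc_instance.
Local Notation G := (fgc_graph I).
Local Notation V := 'I_(nv G).
Local Notation E := 'I_(ne G).
Local Notation S := (safe I).

(* The vertices of positive level [l] form the [l]-th component of the current
   path; unvisited vertices have level 0. *)
Record state : Type := State { lev : V -> nat; top : nat; sol : {set E} }.

Definition visited (st : state) : {set V} := [set v | 0 < lev st v].

Definition far_end (st : state) (e : E) : option V :=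
  if e \in sol st then None
  else if lev st (ends e).1 == top st then
    if lev st (ends e).2 == top st then None else Some (ends e).2
  else if lev st (ends e).2 == top st then Some (ends e).1 else None.

(* Edges of smaller priority value are used first. *)
Definition prio (st : state) (e : E) (w : V) : nat :=
  if lev st w == 0 then (e \notin S : nat) else (lev st w).+1.

(** A safe edge to a new vertex enlarges the end component, an unsafe one starts a new component.
    For a back edge to [w], taking [minn] with the level of [w] merges all components from that of
    [w] up to the end of the path. *)
Definition use_edge (st : state) (e : E) (w : V) : state :=
  if lev st w == 0 then
    let t := if e \in S then top st else (top st).+1 in
    State (fun v => if v == w then t else lev st v) t (e |: sol st)
  else State (fun v => minn (lev st v) (lev st w)) (lev st w) (e |: sol st).

(** Ties between edges of equal priority are left open. Without a candidate the state stays put, so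
    that surplus rounds do no harm. *)
Definition next_state (st st' : state) : Prop :=
  (exists e w, [/\ far_end st e = Some w,
     forall e' w', far_end st e' = Some w' -> prio st e w <= prio st e' w'
     & st' = use_edge st e w])
  \/ (forall e, far_end st e = None) /\ st' = st.

Lemma far_endP st e w :
  reflect (exists u, [/\ e \notin sol st, joins e u w, lev st u = top st & lev st w <> top st])
          (far_end st e == Some w).
Proof.
rewrite /far_end; apply: (iffP idP).
  case: ifPn => // ne.
  have [E1|/eqP E1] := eqVneq (lev st (ends e).1); have [E2|/eqP E2] := eqVneq (lev st (ends e).2) => // /eqP[<-].
  - by exists (ends e).1; rewrite joins_ends.
  - by exists (ends e).2; rewrite joinsC joins_ends.
move=> [u [/negPf-> juw lu /eqP lw]].
by case/orP: juw => /eqP -> /=; rewrite lu eqxx (negPf lw).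
Qed.

Definition inner_edges (st : state) : {set E} :=
  [set e | (0 < lev st (ends e).1) && (lev st (ends e).1 == lev st (ends e).2)].

Lemma inner_edgesE st e u v :
  joins e u v -> (e \in inner_edges st) = (0 < lev st u) && (lev st u == lev st v).
Proof.
rewrite inE => /orP[] /eqP -> //=; rewrite (eq_sym (lev st u)).
by case: eqP => [->|_]; rewrite ?andbF.
Qed.

(** [q] counts the contractions. By [inv_sol_lev], [inv_path] and [inv_path_uniq], solution edges
    between components link consecutive ones, exactly one per pair. [inv_safe] says that no safe
    edge of the graph, chosen or not, leaves a component before the last. In [inv_connect], [D] is
    empty or a single unsafe edge, so each component survives such a deletion. *)
Record path_invariant (st : state) (q : nat) : Prop := PathInvariant {
  inv_top_gt0 : 0 < top st;
  inv_top_le : top st <= #|visited st|;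
  inv_lev_le : forall v, lev st v <= top st;
  inv_sol_lev : forall e u v, e \in sol st -> joins e u v ->
    0 < lev st u /\ lev st u <= (lev st v).+1;
  inv_level_ex : forall l, 0 < l <= top st -> exists v, lev st v = l;
  inv_path : forall l, 0 < l < top st ->
    exists e u v, [/\ e \in sol st, joins e u v, lev st u = l & lev st v = l.+1];
  inv_path_uniq : forall e u v e' u' v',
    e \in sol st -> joins e u v -> e' \in sol st -> joins e' u' v' ->
    lev st v < lev st u -> lev st v' < lev st u' -> lev st u = lev st u' -> e = e';
  inv_safe : forall e u v, e \in S -> joins e u v -> 0 < lev st u < top st ->
    lev st v = lev st u;
  inv_connect : forall (D : {set E}) u v, #|D| <= 1 -> D \subset unsafe I ->
    0 < lev st u -> lev st u = lev st v -> connect (adj (sol st :\: D)) u v;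
  inv_card : #|sol st|.+1 = #|visited st| + q;
  (* Each merge of the path has used up a cut, whose two edges in [X] are inner
     edges from then on. *)
  inv_cuts : forall X : {set E}, fgc_feasible X -> 2 * q <= #|X :&: unsafe I :&: inner_edges st|
}.

Section Step.

Variables (st : state) (q : nat).
Hypothesis inv : path_invariant st q.

Lemma unvisited_notin_sol e u v : joins e u v -> lev st v = 0 -> e \notin sol st.
Proof.
move=> j lv; apply/negP => eS.
by have [] := inv_sol_lev inv eS (etrans (joinsC _ _ _) j); rewrite lv.
Qed.

(** A safe edge lies in no admissible [D], so it attaches [w] to the end component for good. *)
Lemma use_safe_edge e u w :
  e \notin sol st -> joins e u w -> lev st u = top st -> lev st w = 0 -> e \in S ->
  path_invariant (use_edge st e w) q.
Proof.
move=> ne juw lu lw eS; rewrite /use_edge lw eS eqxx; set st' := State _ _ _.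
have t0 := inv_top_gt0 inv.
have lev'w : lev st' w = top st by rewrite /= eqxx.
have lev'P v : 0 < lev st v -> lev st' v = lev st v.
  by move=> h /=; case: eqP h => // ->; rewrite lw.
have lev'u : lev st' u = top st by rewrite lev'P ?lu.
have vis : visited st' = w |: visited st.
  by apply/setP => v; rewrite !inE /=; case: eqP.
have nw : w \notin visited st by rewrite inE lw.
have cvis : #|visited st'| = #|visited st|.+1 by rewrite vis cardsU1 nw.
have olds e' x y : e' \in sol st -> joins e' x y ->
    lev st' x = lev st x /\ lev st' y = lev st y.
  move=> e's jxy; rewrite !lev'P //.
  - by have [] := inv_sol_lev inv e's (etrans (joinsC _ _ _) jxy).
  - by have [] := inv_sol_lev inv e's jxy.
have news x y : joins e x y -> lev st' x = top st /\ lev st' y = top st.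
  by move=> /(joins_eq juw)[][-> ->].
split=> //.
- by rewrite cvis leqW //; exact: (inv_top_le inv).
- by move=> v /=; case: eqP => // _; exact: (inv_lev_le inv v).
- move=> e' x y /setU1P[->|e's] j; first by have [-> ->] := news _ _ j.
  by have [-> ->] := olds _ _ _ e's j; exact: (inv_sol_lev inv e's j).
- move=> l lP; have [v lv] := inv_level_ex inv lP.
  by exists v; rewrite lev'P ?lv //; case/andP: lP.
- move=> l lP; have [e' [x [y [e's j lx ly]]]] := inv_path inv lP.
  exists e', x, y; have [-> ->] := olds _ _ _ e's j.
  by split=> //; rewrite inE e's orbT.
- move=> e1 x1 y1 e2 x2 y2 /setU1P[->|s1] j1; first by have [-> ->] := news _ _ j1; rewrite ltnn.
  move=> /setU1P[->|s2] j2; first by have [-> ->] := news _ _ j2; rewrite ltnn.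
  have [-> ->] := olds _ _ _ s1 j1; have [-> ->] := olds _ _ _ s2 j2.
  exact: (inv_path_uniq inv) s1 j1 s2 j2.
- move=> e' x y e'S j /= ; case: (x =P w) => [_|_ lx]; first by rewrite ltnn andbF.
  have ly := inv_safe inv e'S j lx.
  by case: eqP => // yw; move: ly lx; rewrite yw lw => <-.
- move=> D x y D1 DU.
  have eD : e \in (e |: sol st) :\: D.
    by rewrite !inE eqxx andbT; apply/negP => /(subsetP DU); rewrite inE eS.
  have sub : sol st :\: D \subset (e |: sol st) :\: D by rewrite setSD // subsetUr.
  have cuw : connect (adj ((e |: sol st) :\: D)) u w by exact: connect_edge eD juw.
  have top_case z : lev st z = top st -> connect (adj ((e |: sol st) :\: D)) w z.
    move=> lz; rewrite connect_adj_sym in cuw; apply: connect_trans cuw _.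
    by apply: connect_adj_sub sub _; apply: (inv_connect inv) => //; rewrite lu ?lz.
  rewrite /=; case: (x =P w) => [->|_]; case: (y =P w) => [->|_] lx lxy //.
  - exact: top_case.
  - by rewrite connect_adj_sym; exact: top_case.
  - by apply: connect_adj_sub sub _; exact: (inv_connect inv).
- by rewrite cvis /= cardsU1 ne addSn -(inv_card inv).
- move=> X fX; apply: leq_trans (inv_cuts inv fX) _.
  apply/subset_leq_card/setIS/subsetP => e'; rewrite !inE => /andP[h /eqP hh].
  by rewrite !lev'P -?hh // h eqxx.
Qed.

(** The old end component now falls under [inv_safe]; the priorities give this, as a safe edge to a
    new vertex would have been preferred to [e]. *)
Lemma use_unsafe_edge e u w :
  e \notin sol st -> joins e u w -> lev st u = top st -> lev st w = 0 -> e \notin S ->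
  (forall e' w', far_end st e' = Some w' -> prio st e w <= prio st e' w') ->
  path_invariant (use_edge st e w) q.
Proof.
move=> ne juw lu lw eS pr; rewrite /use_edge lw (negPf eS) eqxx; set st' := State _ _ _.
have t0 := inv_top_gt0 inv.
have lev'w : lev st' w = (top st).+1 by rewrite /= eqxx.
have lev'P v : 0 < lev st v -> lev st' v = lev st v.
  by move=> h /=; case: eqP h => // ->; rewrite lw.
have lev'u : lev st' u = top st by rewrite lev'P ?lu.
have vis : visited st' = w |: visited st.
  by apply/setP => v; rewrite !inE /=; case: eqP.
have nw : w \notin visited st by rewrite inE lw.
have cvis : #|visited st'| = #|visited st|.+1 by rewrite vis cardsU1 nw.
have olds e' x y : e' \in sol st -> joins e' x y ->
    lev st' x = lev st x /\ lev st' y = lev st y.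
  move=> e's jxy; rewrite !lev'P //.
  - by have [] := inv_sol_lev inv e's (etrans (joinsC _ _ _) jxy).
  - by have [] := inv_sol_lev inv e's jxy.
have news x y : joins e x y -> (lev st' x = top st /\ lev st' y = (top st).+1)
    \/ (lev st' x = (top st).+1 /\ lev st' y = top st).
  by move=> /(joins_eq juw)[][-> ->]; [left|right].
split=> //.
- by rewrite cvis ltnS; exact: (inv_top_le inv).
- by move=> v /=; case: eqP => // _; rewrite leqW //; exact: (inv_lev_le inv v).
- move=> e' x y /setU1P[->|e's] j.
    by case: (news _ _ j) => -[-> ->]; rewrite ?t0 /=; lia.
  by have [-> ->] := olds _ _ _ e's j; exact: (inv_sol_lev inv e's j).
- move=> l /= /andP[l0]; rewrite leq_eqVlt => /predU1P[->|lt]; first by exists w; rewrite eqxx.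
  have lP : 0 < l <= top st by rewrite l0.
  have [v lv] := inv_level_ex inv lP.
  by exists v; rewrite -[LHS]/(lev st' v) lev'P ?lv.
- move=> l /= /andP[l0]; rewrite ltnS leq_eqVlt => /predU1P[->|lt].
    exists e, u, w; split=> //; first by rewrite inE set11.
  have lP : 0 < l < top st by rewrite l0.
  have [e' [x [y [e's j lx ly]]]] := inv_path inv lP.
  exists e', x, y; have [h1 h2] := olds _ _ _ e's j.
  by split; [rewrite inE e's orbT | | exact: etrans h1 lx | exact: etrans h2 ly].
- have low e' x y : e' \in sol st -> joins e' x y -> lev st' x <= top st.
    by move=> s j; have [-> _] := olds _ _ _ s j; exact: (inv_lev_le inv).
  have new_top x y : joins e x y -> lev st' y < lev st' x -> lev st' x = (top st).+1.
    by move=> /news[][-> ->] //; lia.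
  move=> e1 x1 y1 e2 x2 y2 /setU1P[->|s1] j1 /setU1P[->|s2] j2 // lt1 lt2 eq12.
  + by have := low _ _ _ s2 j2; rewrite -eq12 (new_top _ _ j1 lt1) ltnn.
  + by have := low _ _ _ s1 j1; rewrite eq12 (new_top _ _ j2 lt2) ltnn.
  have [e1x e1y] := olds _ _ _ s1 j1; have [e2x e2y] := olds _ _ _ s2 j2.
  rewrite e1x e1y e2x e2y in lt1 lt2 eq12.
  exact: (inv_path_uniq inv) s1 j1 s2 j2 lt1 lt2 eq12.
- move=> e' x y e'S j /= ; case: (x =P w) => [_|_ /andP[lx0]]; first by rewrite ltnn andbF.
  rewrite ltnS leq_eqVlt => /predU1P[lx|lt]; last first.
    have ly := inv_safe inv e'S j (introT andP (conj lx0 lt)).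
    by case: eqP => // yw; move: ly lx0; rewrite yw lw => <-.
  have [ly|/eqP ly] := eqVneq (lev st y) (top st).
    by case: eqP => [yw|_]; [move: ly t0; rewrite yw lw => <- |rewrite ly].
  (* Here [x] is in the old end component and [y] outside it: an unvisited [y] contradicts the
     choice of [e], and for a visited [y] the old [inv_safe] applies from its side. *)
  have [ly0|ly0] := posnP (lev st y).
    have ns := unvisited_notin_sol j ly0.
    have /eqP/pr : far_end st e' == Some y by apply/far_endP; exists x.
    by rewrite /prio lw ly0 !eqxx e'S eS.
  rewrite joinsC in j.
  have := inv_safe inv e'S j; rewrite lx ly0 => /(_ _) h; have := h _.
  by rewrite /= ltn_neqAle (inv_lev_le inv) // andbT => /(_ (introN eqP ly)) e0; case: ly.
- move=> D x y D1 DU.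
  have sub : sol st :\: D \subset (e |: sol st) :\: D by rewrite setSD // subsetUr.
  have lt z : lev st z = (top st).+1 -> False.
    by move=> h; have := inv_lev_le inv z; rewrite h ltnn.
  rewrite /=; case: (x =P w) => [->|_]; case: (y =P w) => [->|_] lx lxy //.
  - by case: (lt y).
  - by case: (lt x).
  - by apply: connect_adj_sub sub _; exact: (inv_connect inv).
- by rewrite cvis /= cardsU1 ne addSn -(inv_card inv).
- move=> X fX; apply: leq_trans (inv_cuts inv fX) _.
  apply/subset_leq_card/setIS/subsetP => e'; rewrite !inE => /andP[h /eqP hh].
  by rewrite !lev'P -?hh // h eqxx.
Qed.

(** The components from that of [w] to the end of the path form a cycle closed by [e], and deleting
    at most one edge leaves a way around on one side or the other. *)
Lemma merge_connect e u w (D : {set E}) x :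
  e \notin sol st -> joins e u w -> lev st u = top st -> 0 < lev st w ->
  #|D| <= 1 -> D \subset unsafe I -> lev st w <= lev st x ->
  connect (adj ((e |: sol st) :\: D)) w x.
Proof.
move=> ne juw lu lw D1 DU lx; set F := (e |: sol st) :\: D.
have sub : sol st :\: D \subset F by rewrite setSD // subsetUr.
have same y z : 0 < lev st y -> lev st y = lev st z -> connect (adj F) y z.
  by move=> l0 l; apply: connect_adj_sub sub _; apply: (inv_connect inv).
have Duniq d d' : d \in D -> d' \in D -> d = d'.
  by move=> dD d'D; have /card_le1_eqP/(_ d d' dD d'D) -> := D1.
(* Climb the path from [w] to [x]; a deleted edge on the way makes the other
   part of the cycle available. *)
have up i : lev st w + i <= top st ->
    (forall y, lev st y = lev st w + i -> connect (adj F) w y) \/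
    exists d p r, [/\ d \in D, d \in sol st, joins d p r, lev st r = (lev st p).+1
                    & lev st r <= lev st w + i].
  elim: i => [|i IH] it; first by left=> y ly; apply: same => //; rewrite ly addn0.
  case: IH => [|IH|]; first by lia.
    have [|d [p [r [ds j lp lr]]]] := inv_path inv (_ : 0 < lev st w + i < top st); first by lia.
    have [dD|dD] := boolP (d \in D); first by right; exists d, p, r; split=> //; lia.
    left=> y ly; apply: connect_trans (IH _ lp) _.
    apply: connect_trans (_ : connect _ p r) _; last by apply: same; lia.
    by apply: (connect_edge (e := d)); rewrite // !inE dD ds orbT.
  by move=> [d [p [r [dD ds j lr le]]]]; right; exists d, p, r; split=> //; lia.
have lxt := inv_lev_le inv x.
case: (up (lev st x - lev st w)); first by lia.
  by apply; lia.
move=> [d [p [r [dD ds jpr lr le]]]].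
have eF : e \in F.
  by rewrite !inE eqxx andbT; apply: contra ne => eD; rewrite (Duniq _ _ eD dD).
have cwu : connect (adj F) w u by rewrite connect_adj_sym; exact: connect_edge eF juw.
apply: connect_trans cwu _.
(* [x] is at or above the level of [r], the upper end of the deleted edge [d]. The descent from the
   end of the path stops there and so never crosses [d], the only element of [D]. *)
have down i y : i <= top st - lev st r -> lev st y = top st - i -> connect (adj F) u y.
  elim: i y => [|i IH] y ir ly.
    by apply: same; rewrite ?ly lu ?subn0 // (inv_top_gt0 inv).
 
  have [|d' [p' [r' [d's j' lp' lr']]]] := inv_path inv (_ : 0 < lev st y < top st).
    by move: ir ly lr; clear; lia.
  have d'D : d' \notin D.
    apply/negP => d'D; rewrite (Duniq _ _ d'D dD) in j'.
    by case: (joins_eq jpr j') => -[hp hr]; move: lp' lr' lr ir ly; rewrite hp hr; clear; lia.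
  have lr1 : lev st r' = top st - i by move: lr' ly ir; clear; lia.
  apply: connect_trans (IH r' (ltnW ir) lr1) _.
  apply: connect_trans (_ : connect _ r' p') _; last by apply: same => //; move: lp' ly ir lr; clear; lia.
  by rewrite connect_adj_sym; apply: (connect_edge (e := d')); rewrite // !inE d'D d's orbT.
by apply: (down (top st - lev st x)); move: lxt le lx; clear; lia.
Qed.

(** A solution edge leaving the end component drops by one level only. Any other edge leaving it is
    a candidate, of priority at least [(lev st w).+1 >= 2], so its far end is visited and not below
    the level of [w]. A safe one would contradict [inv_safe] at that far end. *)
Lemma top_cut e u w e' x y :
  far_end st e = Some w -> joins e u w -> 0 < lev st w ->
  (forall e' w', far_end st e' = Some w' -> prio st e w <= prio st e' w') ->
  joins e' x y -> lev st x = top st -> lev st y <> top st ->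
  e' \notin S /\ lev st w <= lev st y.
Proof.
move=> /eqP/far_endP[_ [_ _ _ lw']] juw lw pr j lx ly.
have lwt : lev st w < top st by have := inv_lev_le inv w; lia.
have lyt : lev st y < top st by have := inv_lev_le inv y; lia.
have le : lev st w <= lev st y.
  have [e's|ns] := boolP (e' \in sol st).
    by have [_] := inv_sol_lev inv e's j; lia.
  have /eqP/pr : far_end st e' == Some y by apply/far_endP; exists x.
  rewrite /prio; have /negPf -> : lev st w != 0 by lia.
  by case: ifP => // _; case: (e' \notin S); lia.
split=> //; apply/negP => e'S; rewrite joinsC in j.
have := inv_safe inv e'S j; lia.
Qed.

(** An edge is added but no vertex, so [q] grows by one; the two extra inner edges of [X] come from
    the cut around the end component. *)
Lemma use_back_edge e u w :
  e \notin sol st -> joins e u w -> lev st u = top st -> 0 < lev st w -> lev st w <> top st ->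
  (forall e' w', far_end st e' = Some w' -> prio st e w <= prio st e' w') ->
  path_invariant (use_edge st e w) q.+1.
Proof.
move=> ne juw lu lw nlw pr; rewrite /use_edge.
have /negPf -> : lev st w != 0 by lia.
set st' := State _ _ _.
have lwt : lev st w < top st by have := inv_lev_le inv w; lia.
have vis : visited st' = visited st.
  by apply/setP => v; rewrite !inE /=; lia.
have news x y : joins e x y -> lev st' x = lev st w /\ lev st' y = lev st w.
  by move=> /(joins_eq juw)[][-> ->] /=; lia.
split=> //.
- by rewrite vis /= (leq_trans (ltnW lwt)) // (inv_top_le inv).
- by move=> v /=; lia.
- move=> e' x y /setU1P[->|e's] j; first by have [-> ->] := news _ _ j.
  by have := inv_sol_lev inv e's j; rewrite /=; lia.
- move=> l lP; have [|v lv] := inv_level_ex inv (_ : 0 < l <= top st); first by move: lP => /=; lia.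
  by exists v; move: lP => /=; lia.
- move=> l lP; have [|e' [x [y [e's j lx ly]]]] := inv_path inv (_ : 0 < l < top st).
    by move: lP => /=; lia.
  by exists e', x, y; move: lP => /= lP; split; rewrite ?inE ?e's ?orbT //; lia.
(* An edge that still descends after the merge has its upper end at most at the level of [w], where
   levels do not change. *)
- have keep e' x y : e' \in sol st -> joins e' x y -> lev st' y < lev st' x ->
      lev st' x = lev st x /\ lev st' y = lev st y.
    move=> e's j /=; have := inv_sol_lev inv e's j; lia.
  move=> e1 x1 y1 e2 x2 y2 /setU1P[->|s1] j1; first by have [-> ->] := news _ _ j1; rewrite ltnn.
  move=> /setU1P[->|s2] j2; first by have [-> ->] := news _ _ j2; rewrite ltnn.
  move=> lt1 lt2 eq12.
  have [e1x e1y] := keep _ _ _ s1 j1 lt1; have [e2x e2y] := keep _ _ _ s2 j2 lt2.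
  rewrite e1x e1y e2x e2y in lt1 lt2 eq12.
  exact: (inv_path_uniq inv) s1 j1 s2 j2 lt1 lt2 eq12.
- move=> e' x y e'S j /= lx; have := inv_safe inv e'S j; lia.
- move=> D x y D1 DU lx lxy.
  have [lt|ge] := ltnP (lev st x) (lev st w).
    apply: connect_adj_sub (inv_connect inv D1 DU _ _); first by rewrite setSD // subsetUr.
    - by move: lx => /=; lia.
    - by move: lxy => /=; lia.
  have ge' : lev st w <= lev st y by move: lxy => /=; lia.
  apply: (@connect_trans _ _ w); last exact: (merge_connect ne juw lu lw D1 DU ge').
  by rewrite connect_adj_sym; exact: (merge_connect ne juw lu lw D1 DU ge).
- by rewrite vis /= cardsU1 ne add1n addnS -(inv_card inv).
- move=> X /andP[cX /forall_inP X2].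
  have fe : far_end st e = Some w by apply/eqP/far_endP; exists u.
  pose W v := lev st v == top st.
  have Wu : W u by apply/eqP.
  have Ww : ~~ W w by apply/eqP.
  (* Every edge of the cut is unsafe, was not inner, and becomes inner, as its far end is at or
     above the level of [w]. *)
  have inn e' x y : joins e' x y -> W x -> ~~ W y ->
      e' \in unsafe I :&: inner_edges st' :\: inner_edges st.
    move=> j /eqP lx /eqP ly; have [ns le] := top_cut fe juw lw pr j lx ly.
    rewrite in_setD in_setI in_setC ns !(inner_edgesE _ j) /= lx.
    by have := inv_lev_le inv y; lia.
  have [e1 [x1 [y1 [X1 j1 Wx1 Wy1]]]] := connected_cut cX Wu Ww.
  have in1 := inn _ _ _ j1 Wx1 Wy1.
  have U1 : e1 \in unsafe I by move: in1; rewrite !in_setD !in_setI => /and3P[].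
  have cX1 : connected (X :\ e1) by apply: X2; rewrite in_setI X1.
  (* [e1] is unsafe, so feasibility of [X] leaves a second edge of the same cut after its
     deletion. *)
  have [e2 [x2 [y2 [X2' j2 Wx2 Wy2]]]] := connected_cut cX1 Wu Ww.
  have in2 := inn _ _ _ j2 Wx2 Wy2.
  move: X2'; rewrite in_setD1 => /andP[e21 X2'].
  have fX : fgc_feasible X by rewrite /fgc_feasible cX; apply/forall_inP.
  set A := X :&: unsafe I :&: inner_edges st.
  have h : #|e1 |: (e2 |: A)| = #|A|.+2.
    rewrite !cardsU1 !inE (eq_sym e1) (negPf e21) /=.
    by move: in1 in2; rewrite !in_setD => /andP[/negPf h1 _] /andP[/negPf h2 _];
       rewrite !inE in h1 h2; rewrite h1 h2 !andbF.
  have := subset_leq_card (_ : e1 |: (e2 |: A) \subset X :&: unsafe I :&: inner_edges st').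
  rewrite h => hh; apply: leq_trans (hh _).
    by rewrite mulnS !ltnS; exact: (inv_cuts inv).
  move: in1 in2; rewrite !in_setD !in_setI => /and3P[_ U1' N1] /and3P[_ U2 N2].
  apply/subsetP => f; rewrite !in_setU1 !in_setI => /or3P[/eqP->|/eqP->|].
  - by rewrite X1 U1' N1.
  - by rewrite X2' U2 N2.
  - move=> /andP[-> ]; rewrite /=.
    rewrite !(inner_edgesE _ (joins_ends f)) /= => /andP[l0 /eqP <-].
    by rewrite eqxx andbT leq_min l0.
Qed.

End Step.

(** A new vertex lowers the first term by 2 and raises [top] by at most 1; a back edge lowers [top].
    Under the invariant, the value 0 means that all vertices lie in one component. *)
Definition remaining (st : state) : nat := 2 * (nv G - #|visited st|) + (top st).-1.

(** By [inv_path_uniq] at most one solution edge leaves the end component, and it is unsafe by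
    [inv_safe]. A feasible [X] has an edge in this cut even after the deletion of that one. *)
Lemma far_end_ex st q (X : {set E}) : path_invariant st q -> fgc_feasible X -> 0 < remaining st ->
  exists e w, far_end st e = Some w.
Proof.
move=> inv /andP[cX /forall_inP X2] r0.
have t0 := inv_top_gt0 inv.
pose W v := lev st v == top st.
have [|u /eqP Wu] := inv_level_ex inv (_ : 0 < top st <= top st); first by rewrite t0 leqnn.
have [w Ww] : exists w, ~~ W w.
  have [t1|t1] := ltnP 1 (top st).
    have [|w lw] := inv_level_ex inv (_ : 0 < 1 <= top st); first by lia.
    by exists w; rewrite /W lw; lia.
  have /card_gt0P[w] : 0 < #|~: visited st|.
    have := cardsC (visited st); rewrite card_ord; move: r0; rewrite /remaining; lia.
  by rewrite !inE => lw; exists w; rewrite /W; lia.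
have [e1 [x1 [y1 [X1 j1 Wx1 Wy1]]]] := connected_cut cX Wu Ww.
have [s1|s1] := boolP (e1 \in sol st); last first.
  by exists e1, y1; apply/eqP/far_endP; exists x1; split=> //; apply/eqP.
have lt1 : lev st y1 < lev st x1.
  by move: Wx1 Wy1; rewrite /W => /eqP ->; have := inv_lev_le inv y1; clear; lia.
have ns : e1 \in unsafe I.
  rewrite inE; apply/negP => e1S; rewrite joinsC in j1.
  have [ly0 _] := inv_sol_lev inv s1 j1.
  have := inv_safe inv e1S j1; have := inv_lev_le inv x1; lia.
have cX1 : connected (X :\ e1) by apply: X2; rewrite in_setI X1.
have [e2 [x2 [y2 [X2' j2 Wx2 Wy2]]]] := connected_cut cX1 Wu Ww.
have [s2|s2] := boolP (e2 \in sol st); last first.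
  by exists e2, y2; apply/eqP/far_endP; exists x2; split=> //; apply/eqP.
have lt2 : lev st y2 < lev st x2.
  by move: Wx2 Wy2; rewrite /W => /eqP ->; have := inv_lev_le inv y2; clear; lia.
have := inv_path_uniq inv s1 j1 s2 j2 lt1 lt2; rewrite (eqP Wx1) (eqP Wx2) => /(_ erefl) e12.
by move: X2'; rewrite e12 !inE eqxx.
Qed.

(** Without a candidate, [far_end_ex] gives [remaining st = 0], and the predecessor of 0 is 0. *)
Lemma next_state_invariant st st' q (X : {set E}) :
  path_invariant st q -> fgc_feasible X -> next_state st st' ->
  exists2 q', path_invariant st' q' & remaining st' <= (remaining st).-1.
Proof.
move=> inv fX [[e [w [fe pr ->]]]|[none ->]]; last first.
  exists q => //; rewrite leqNgt; apply/negP => h.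
  have [|e [w]] := far_end_ex inv fX; first by lia.
  by rewrite none.
have /eqP/far_endP[u [ne juw lu lw]] := fe.
have t0 := inv_top_gt0 inv.
have vmax (s : state) : #|visited s| <= nv G by have := max_card (mem (visited s)); rewrite card_ord.
have [lw0|lw0] := posnP (lev st w).
  have cv t F : 0 < t -> #|visited (State (fun v => if v == w then t else lev st v) t F)|
      = #|visited st|.+1.
    move=> t1; rewrite (_ : visited _ = w |: visited st); last first.
      by apply/setP => v; rewrite !inE /=; case: eqP.
    by rewrite cardsU1 inE lw0.
  have [eS|eS] := boolP (e \in S).
    exists q; first exact: use_safe_edge juw lu lw0 eS.
    have:= vmax (use_edge st e w); rewrite /remaining /use_edge lw0 eqxx eS /= cv //.
    move: t0 (#|_|) (top _); clear; lia.
  exists q; first exact: use_unsafe_edge juw lu lw0 eS pr.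
  have:= vmax (use_edge st e w); rewrite /remaining /use_edge lw0 eqxx (negPf eS) /= cv //.
  move: (top _) t0 (#|_|); clear; lia.
exists q.+1; first exact: use_back_edge juw lu lw0 lw pr.
have -> : remaining (use_edge st e w) = 2 * (nv G - #|visited st|) + (lev st w).-1.
  rewrite /remaining /use_edge; have /negPf -> : lev st w != 0 by lia.
  by rewrite (_ : visited _ = visited st) //; apply/setP => v; rewrite !inE /=; lia.
by have := inv_lev_le inv w; rewrite /remaining; lia.
Qed.

Definition start_state : state :=
  State (fun v => ((v : nat) == 0)%N : nat) 1 set0.

Lemma start_invariant : path_invariant start_state 0.
Proof.
have n0 := nv_gt0 G; pose v0 : V := Ordinal n0.
have vis : visited start_state = [set v0].
  by apply/setP => v; rewrite !inE /= -val_eqE /=; case: eqP.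
split=> //=.
- by rewrite vis cards1.
- by move=> v; case: eqP.
- by move=> e u v; rewrite inE.
- by move=> l lP; exists v0 => /=; lia.
- by move=> l; lia.
- by move=> e u v e' u' v'; rewrite inE.
- by move=> e u v _ _; lia.
- move=> D u v _ _; case: eqP => // u0 _; case: eqP => // v0' _.
  by rewrite (_ : u = v) //; apply: val_inj; rewrite /= u0 v0'.
- by rewrite vis cards1 cards0.
Qed.

Lemma remaining_start : remaining start_state <= 2 * nv G.
Proof. by rewrite /remaining /=; lia. Qed.

(** All vertices have level 1, so [inv_connect] for empty and for singleton [D] is feasibility. With
    [n] vertices, the bound combines [#|sol st| = n - 1 + q], [n - 1 <= #|X|] and
    [2 * q <= #|X| - #|X :&: S|]. *)
Lemma remaining0_feasible st q : path_invariant st q -> remaining st = 0 ->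
  fgc_feasible (sol st) /\ (forall X : {set E}, fgc_feasible X ->
    2 * #|sol st| + #|X :&: S| <= 3 * #|X|).
Proof.
move=> inv r0.
have [vn t1] : #|visited st| = nv G /\ top st = 1.
  have : #|visited st| <= nv G by have := max_card (mem (visited st)); rewrite card_ord.
  by have := inv_top_gt0 inv; move: r0; rewrite /remaining; lia.
have lev1 v : lev st v = 1.
  have /eqP/setP/(_ v) : visited st == setT.
    by rewrite eqEcard subsetT cardsT card_ord vn /=.
  by rewrite !inE; have := inv_lev_le inv v; lia.
have conn (D : {set E}) : #|D| <= 1 -> D \subset unsafe I -> connected (sol st :\: D).
  by move=> D1 DU; apply/connectedP => u v; apply: (inv_connect inv) => //; rewrite !lev1.
split.
  apply/andP; split; first by rewrite -[sol st]setD0 conn ?cards0 ?sub0set.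
  by apply/forall_inP => e /setIP[_ eU]; rewrite conn ?cards1 ?sub1set.
move=> X fX; have /andP[/connected_card cX _] := fX.
have := subset_leq_card (subsetIl (X :&: unsafe I) (inner_edges st)).
have := inv_cuts inv fX; have := inv_card inv; rewrite vn.
have := cardsID S X; rewrite setDE -/(unsafe I); lia.
Qed.

End PathBased.

(** * List processing on trees *)

Lemma ptime_ext f g : (forall k x, f k x = g k x) -> ptime f -> ptime g.
Proof.
move=> fg [c [b [pb h]]]; exists c, b; split=> // k s sk.
by apply: runs_weaken (h k s sk) _ _ => // s' [-> ->]; rewrite fg.
Qed.

Lemma enc_seqK t : enc_seq (tree_list t) = t.
Proof. by elim: t => //= a _ b ->. Qed.

Lemma tree_listK l : tree_list (enc_seq l) = l.
Proof. by elim: l => //= a l ->. Qed.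

Lemma lst_enc_seq k l : size l <= fuel k -> lst k (enc_seq l) = l.
Proof. by move=> h; rewrite /lst tree_listK take_oversize. Qed.

Lemma enc_natE n : enc_nat n = enc_seq (nseq n Leaf).
Proof. by elim: n => //= n ->. Qed.

Lemma lst_enc_nat k n : n <= fuel k -> lst k (enc_nat n) = nseq n Leaf.
Proof. by move=> h; rewrite enc_natE lst_enc_seq ?size_nseq. Qed.

Lemma foldl_consE t l :
  foldl (fun acc it => Node it acc) t l = enc_seq (catrev l (tree_list t)).
Proof. by elim: l t => [|a l IH] t /=; rewrite ?enc_seqK // IH. Qed.

Definition revT (k l : tree) : tree := foldl (fun acc it => Node it acc) Leaf (lst k l).

Lemma revTE k l : revT k l = enc_seq (rev (lst k l)).
Proof. by rewrite /revT foldl_consE. Qed.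

Ltac ptime_tac :=
  repeat first
    [ exact: ptime_arg | exact: ptime_key | exact: ptime_leaf | assumption
    | apply: ptime_node | apply: ptime_hd | apply: ptime_tl | apply: ptime_if
    | apply: ptime_foldl
    | match goal with H : ptime ?f |- ptime (fun k x => ?f k _) => apply: (ptime_comp H) end ].

Lemma ptime_revT f : ptime f -> ptime (fun k x => revT k (f k x)).
Proof. by move=> hf; rewrite /revT; ptime_tac. Qed.

Lemma ptime_foldr step init l :
  ptime (fun k y => step k (tree_tl (tree_tl y)) (tree_hd (tree_tl y)) (tree_hd y)) ->
  ptime init -> ptime l ->
  ptime (fun k x => foldr (step k x) (init k x) (lst k (l k x))).
Proof.
move=> hs hi hl.
apply: (@ptime_ext (fun k x => foldl (fun acc it => step k x it acc) (init k x)
                                 (lst k (revT k (l k x))))); last first.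
  by apply: ptime_foldl => //; apply: ptime_revT.
move=> k x; rewrite revTE lst_enc_seq ?foldl_rev //.
by rewrite size_rev /lst size_take; case: ltnP.
Qed.

(** A unary number is a list of leaves, so a loop over [i] has [i] rounds. *)
Definition dropT (k l i : tree) : tree := foldl (fun acc _ => tree_tl acc) l (lst k i).

Definition leqT (k a b : tree) : tree := enc_bool (~~ is_node (dropT k a b)).

Definition eqT (k a b : tree) : tree :=
  if is_node (leqT k a b) then leqT k b a else Leaf.

Definition nthT (k l i : tree) : tree := tree_hd (dropT k l i).

Definition restoreT (k v p : tree) : tree :=
  foldl (fun acc it => Node it acc) (Node v (tree_tl (tree_tl p))) (lst k (tree_hd p)).

(** The first [i] entries are shifted onto a reversed prefix, the entry after them is replaced, and
    the prefix is put back. *)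
Definition set_nthT (k l i v : tree) : tree :=
  restoreT k v (foldl (fun acc _ => Node (Node (tree_hd (tree_tl acc)) (tree_hd acc))
                                         (tree_tl (tree_tl acc)))
                      (Node Leaf l) (lst k i)).

Definition zipT (k a b : tree) : tree :=
  revT k (tree_tl (foldl (fun acc it => Node (tree_tl (tree_hd acc))
                            (Node (Node it (tree_hd (tree_hd acc))) (tree_tl acc)))
                         (Node b Leaf) (lst k a))).

Definition countT (k l : tree) : tree :=
  foldl (fun acc it => if is_node it then Node Leaf acc else acc) Leaf (lst k l).

Definition capT (k l b : tree) : tree :=
  foldr (fun it out => Node (if is_node (leqT k it b) then it else b) out) Leaf (lst k l).

Lemma ptime_dropT f g : ptime f -> ptime g -> ptime (fun k x => dropT k (f k x) (g k x)).
Proof. by move=> hf hg; rewrite /dropT; ptime_tac. Qed.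

Lemma ptime_leqT f g : ptime f -> ptime g -> ptime (fun k x => leqT k (f k x) (g k x)).
Proof.
move=> hf hg; apply: (@ptime_ext (fun k x => if is_node (dropT k (f k x) (g k x)) then Leaf
  else Node Leaf Leaf)); first by move=> k x; rewrite /leqT; case: is_node.
by ptime_tac; exact: ptime_dropT.
Qed.

Lemma ptime_eqT f g : ptime f -> ptime g -> ptime (fun k x => eqT k (f k x) (g k x)).
Proof. by move=> hf hg; rewrite /eqT; ptime_tac; exact: ptime_leqT. Qed.

Lemma ptime_nthT f g : ptime f -> ptime g -> ptime (fun k x => nthT k (f k x) (g k x)).
Proof. by move=> hf hg; rewrite /nthT; ptime_tac; exact: ptime_dropT. Qed.

Lemma ptime_set_nthT f g h : ptime f -> ptime g -> ptime h ->
  ptime (fun k x => set_nthT k (f k x) (g k x) (h k x)).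
Proof. by move=> hf hg hh; rewrite /set_nthT /restoreT; ptime_tac. Qed.

Lemma ptime_zipT f g : ptime f -> ptime g -> ptime (fun k x => zipT k (f k x) (g k x)).
Proof. by move=> hf hg; rewrite /zipT; apply: ptime_revT; ptime_tac. Qed.

Lemma ptime_countT f : ptime f -> ptime (fun k x => countT k (f k x)).
Proof. by move=> hf; rewrite /countT; ptime_tac. Qed.

Lemma ptime_capT f g : ptime f -> ptime g -> ptime (fun k x => capT k (f k x) (g k x)).
Proof.
by move=> hf hg; rewrite /capT; apply: ptime_foldr; ptime_tac; apply: ptime_leqT; ptime_tac.
Qed.

Ltac ptime_auto :=
  repeat first
    [ progress ptime_tac | apply: ptime_foldr | apply: ptime_revT | apply: ptime_leqT
    | apply: ptime_eqT | apply: ptime_nthT | apply: ptime_set_nthT | apply: ptime_zipT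
    | apply: ptime_countT | apply: ptime_capT ].

(** Here and in the following lemmas, bounds by [fuel k] ensure that no loop is cut off early. *)
Lemma dropT_nat k a b : b <= fuel k -> dropT k (enc_nat a) (enc_nat b) = enc_nat (a - b).
Proof.
move=> h; rewrite /dropT lst_enc_nat //; elim: b a {h} => [|b IH] a /=; first by rewrite subn0.
have -> : tree_tl (enc_nat a) = enc_nat a.-1 by case: a.
by rewrite IH -subn1 -subnDA.
Qed.

Lemma is_node_bool b : is_node (enc_bool b) = b.
Proof. by case: b. Qed.

Lemma is_node_nat n : is_node (enc_nat n) = (0 < n).
Proof. by case: n. Qed.

Lemma leqT_nat k a b : b <= fuel k -> leqT k (enc_nat a) (enc_nat b) = enc_bool (a <= b).
Proof. by move=> h; rewrite /leqT dropT_nat // is_node_nat subn_gt0 -leqNgt. Qed.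

Lemma eqT_nat k a b : a <= fuel k -> b <= fuel k ->
  eqT k (enc_nat a) (enc_nat b) = enc_bool (a == b).
Proof.
by move=> ha hb; rewrite /eqT !leqT_nat // is_node_bool eqn_leq; case: (a <= b).
Qed.

Lemma dropT_seq k l i : i <= fuel k -> dropT k (enc_seq l) (enc_nat i) = enc_seq (drop i l).
Proof.
move=> h; rewrite /dropT lst_enc_nat //; elim: i l {h} => [|i IH] l /=; first by rewrite drop0.
have -> : tree_tl (enc_seq l) = enc_seq (behead l) by case: l.
by rewrite IH; case: l.
Qed.

Lemma nthT_seq k l i : i <= fuel k -> nthT k (enc_seq l) (enc_nat i) = nth Leaf l i.
Proof.
move=> h; rewrite /nthT dropT_seq // -[i in RHS]addn0 -nth_drop.
by case: (drop i l).
Qed.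

Lemma nthT_enum k n (f : 'I_n -> tree) (i : 'I_n) : n <= fuel k ->
  nthT k (enc_seq [seq f j | j <- enum 'I_n]) (enc_nat i) = f i.
Proof.
move=> h; rewrite nthT_seq ?(leq_trans (ltnW (ltn_ord i))) //.
by rewrite (nth_map i) ?size_enum_ord // nth_ord_enum.
Qed.

Lemma set_nthT_seq k l i v : i < size l -> i <= fuel k ->
  set_nthT k (enc_seq l) (enc_nat i) v = enc_seq (set_nth Leaf l i v).
Proof.
move=> il h; rewrite /set_nthT lst_enc_nat //.
have E j p : j <= size l -> foldl (fun acc _ => Node (Node (tree_hd (tree_tl acc)) (tree_hd acc))
    (tree_tl (tree_tl acc))) (Node (enc_seq p) (enc_seq l)) (nseq j Leaf)
    = Node (enc_seq (catrev (take j l) p)) (enc_seq (drop j l)).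
  elim: j (l) p {il h} => [|j IH] [|a l'] p //= hj.
  by rewrite -[Node a _]/(enc_seq (a :: p)) IH.
rewrite (E i [::]) ?(ltnW il) // /restoreT /=.
rewrite foldl_consE lst_enc_seq; last by rewrite size_rev size_take il.
rewrite -/(rev (take i l)) catrevE revK set_nthE il (drop_nth Leaf il) /=.
by rewrite tree_listK.
Qed.

Lemma set_nthT_enum k n (f : 'I_n -> tree) (i : 'I_n) v : n <= fuel k ->
  set_nthT k (enc_seq [seq f j | j <- enum 'I_n]) (enc_nat i) v =
  enc_seq [seq if j == i then v else f j | j <- enum 'I_n].
Proof.
move=> h; have hi := ltn_ord i.
have hik : i <= fuel k by rewrite (leq_trans (ltnW hi)).
rewrite set_nthT_seq //; last by rewrite size_map size_enum_ord.
congr (enc_seq _).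
apply: (@eq_from_nth _ Leaf).
  by rewrite size_set_nth 2!size_map size_enum_ord; apply/maxn_idPr.
rewrite size_set_nth size_map size_enum_ord (maxn_idPr hi) => j hj.
rewrite nth_set_nth /= 2?(nth_map i) ?size_enum_ord //.
suff -> : (nth i (enum 'I_n) j == i) = (j == i :> nat) by [].
by rewrite -[LHS]val_eqE [val _]nth_enum_ord.
Qed.

Lemma zipT_seq k a b : size a <= size b -> size a <= fuel k ->
  zipT k (enc_seq a) (enc_seq b) = enc_seq [seq Node p.1 p.2 | p <- zip a b].
Proof.
move=> ab ha; rewrite /zipT lst_enc_seq //.
have E c l : size a <= size c -> tree_tl (foldl (fun acc it => Node (tree_tl (tree_hd acc))
      (Node (Node it (tree_hd (tree_hd acc))) (tree_tl acc))) (Node (enc_seq c) (enc_seq l)) a)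
    = enc_seq (catrev [seq Node p.1 p.2 | p <- zip a c] l).
  elim: a c l {ab ha} => [|x a IH] [|y c] l //= h.
  by rewrite -[Node (Node x y) _]/(enc_seq (Node x y :: l)) IH.
rewrite (E b [::]) // revTE lst_enc_seq ?revK //.
by rewrite size_rev size_map size_zip (minn_idPl ab).
Qed.

Lemma zipT_enum k n (f g : 'I_n -> tree) : n <= fuel k ->
  zipT k (enc_seq [seq f j | j <- enum 'I_n]) (enc_seq [seq g j | j <- enum 'I_n]) =
  enc_seq [seq Node (f j) (g j) | j <- enum 'I_n].
Proof.
move=> h; rewrite zipT_seq; [|by rewrite 2!size_map|by rewrite size_map size_enum_ord].
by congr (enc_seq _); elim: (enum 'I_n) => //= x s ->.
Qed.

Lemma countT_set k n (F : {set 'I_n}) : n <= fuel k -> countT k (enc_set F) = enc_nat #|F|.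
Proof.
move=> h; rewrite /countT lst_enc_seq 1?size_map ?size_enum_ord //.
have E s a : foldl (fun acc it => if is_node it then Node Leaf acc else acc) (enc_nat a)
    [seq enc_bool (e \in F) | e <- s] = enc_nat (count (mem F) s + a).
  elim: s a => //= e s IH a; rewrite is_node_bool.
  by case: (e \in F); rewrite -?[Node Leaf (enc_nat a)]/(enc_nat a.+1) IH ?addnS.
by rewrite (E _ 0) addn0 -size_filter cardE enumT.
Qed.

Lemma capT_enum k n (f : 'I_n -> nat) b : n <= fuel k -> b <= fuel k ->
  capT k (enc_seq [seq enc_nat (f j) | j <- enum 'I_n]) (enc_nat b) =
  enc_seq [seq enc_nat (minn (f j) b) | j <- enum 'I_n].
Proof.
move=> h hb; rewrite /capT lst_enc_seq 1?size_map ?size_enum_ord //.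
elim: (enum 'I_n) => //= x s ->; rewrite leqT_nat // is_node_bool; congr Node.
by case: leqP.
Qed.

(** * The path-based algorithm on trees *)

(* The variable [k] is an encoded instance, with vertex number
   [tree_hd (tree_hd k)], edge list [tree_tl (tree_hd k)] and safe edges
   [tree_tl k].  A state is a tree with level list, top level and solution. *)

Definition prioT (a s : tree) : tree :=
  if is_node a then Node Leaf a else if is_node s then Leaf else Node Leaf Leaf.

(* An item is a tree of the form ((u, v), (safe, chosen)). *)
Definition far_endT (k st it : tree) : tree :=
  let u := tree_hd (tree_hd it) in
  let v := tree_tl (tree_hd it) in
  let a := nthT k (tree_hd st) u in
  let b := nthT k (tree_hd st) v in
  let j := tree_hd (tree_tl st) in
  let s := tree_hd (tree_tl it) in
  if is_node (tree_tl (tree_tl it)) then Leaf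
  else if is_node (eqT k a j) then
    if is_node (eqT k b j) then Leaf else Node (prioT b s) v
  else if is_node (eqT k b j) then Node (prioT a s) u else Leaf.

Definition betterT (k c i best : tree) : tree :=
  if is_node c then
    if is_node best then
      if is_node (leqT k (tree_hd best) (tree_hd c)) then best
      else Node (tree_hd c) (Node i (tree_tl c))
    else Node (tree_hd c) (Node i (tree_tl c))
  else best.

(** The accumulator holds the number of the current edge and the best candidate so far, a triple of
    priority, edge number and far end. *)
Definition bestT (k st : tree) : tree :=
  tree_tl (foldl (fun acc it => Node (Node Leaf (tree_hd acc))
                                  (betterT k (far_endT k st it) (tree_hd acc) (tree_tl acc)))
    (Node Leaf Leaf)
    (lst k (zipT k (tree_tl (tree_hd k)) (zipT k (tree_tl k) (tree_tl (tree_tl st)))))).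

(** The priority [p] tells the cases apart: 0 and 1 stand for a safe and an unsafe edge to a new
    vertex, and for a back edge [p] is at least 2 and its predecessor is the level of the far
    end. *)
Definition use_edgeT (k st best : tree) : tree :=
  let p := tree_hd best in
  let F := set_nthT k (tree_tl (tree_tl st)) (tree_hd (tree_tl best)) (Node Leaf Leaf) in
  let j := tree_hd (tree_tl st) in
  let t := if is_node p then Node Leaf j else j in
  if is_node best then
    if is_node (tree_tl p) then Node (capT k (tree_hd st) (tree_tl p)) (Node (tree_tl p) F)
    else Node (set_nthT k (tree_hd st) (tree_tl (tree_tl best)) t) (Node t F)
  else st.

Definition stepT (k st : tree) : tree := use_edgeT k st (bestT k st).

(** The unary vertex number doubles as a list of zeros, one for each vertex; its first entry is
    replaced by 1. *)
Definition startT (k : tree) : tree :=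
  Node (Node (Node Leaf Leaf) (tree_tl (tree_hd (tree_hd k))))
    (Node (Node Leaf Leaf) (foldr (fun _ out => Node Leaf out) Leaf (lst k (tree_tl (tree_hd k))))).

(** There are [fuel k] rounds of two steps each, and [remaining] starts at no more than
    [2 * nv G]. *)
Definition pathT (k : tree) : tree :=
  tree_tl (tree_tl (foldl (fun st _ => stepT k (stepT k st)) (startT k) (lst k (tree_hd k)))).

Lemma ptime_stepT f : ptime f -> ptime (fun k x => stepT k (f k x)).
Proof.
move=> hf; apply: (ptime_comp (f := stepT)) hf; rewrite /stepT.
have hb : ptime bestT.
  by rewrite /bestT /betterT /far_endT /prioT /=; ptime_auto.
by rewrite /use_edgeT /=; ptime_auto.
Qed.

Lemma ptime_pathT : ptime (fun k x => pathT k).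
Proof.
rewrite /pathT; do 2 apply: ptime_tl; apply: ptime_foldl.
- by do 2 apply: ptime_stepT; apply: ptime_hd; exact: ptime_arg.
- by rewrite /startT; ptime_auto.
- by apply: ptime_hd; exact: ptime_key.
Qed.

Section PathTree.

Variable I : fgc_instance.
Local Notation G := (fgc_graph I).
Local Notation V := 'I_(nv G).
Local Notation E := 'I_(ne G).
Local Notation k := (enc_fgc I).

Lemma fuel_enc : fuel k = (ne G).+1.
Proof. by rewrite /fuel /= tree_listK size_map size_enum_ord. Qed.

Lemma ne_le_fuel : ne G <= fuel k.
Proof. by rewrite fuel_enc. Qed.

(** A connected graph has at most one vertex more than edges. *)
Lemma nv_le_fuel : nv G <= fuel k.
Proof. by rewrite fuel_enc; have := connected_card (fgc_connected I); rewrite cardsT card_ord. Qed.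

Definition enc_state (st : state I) : tree :=
  Node (enc_seq [seq enc_nat (lev st v) | v <- enum V])
    (Node (enc_nat (top st)) (enc_set (sol st))).

Definition enc_far (st : state I) (e : E) (o : option V) : tree :=
  if o is Some w then Node (enc_nat (prio st e w)) (enc_nat w) else Leaf.

Definition item (st : state I) (e : E) : tree :=
  Node (Node (enc_nat (ends e).1) (enc_nat (ends e).2))
       (Node (enc_bool (e \in safe I)) (enc_bool (e \in sol st))).

Section StepTree.

Variables (st : state I) (q : nat).
Hypothesis inv : path_invariant st q.

Lemma top_le_nv : top st <= nv G.
Proof.
apply: leq_trans (inv_top_le inv) _.
by have := max_card (mem (visited st)); rewrite card_ord.
Qed.

Lemma lev_le_fuel v : lev st v <= fuel k.
Proof. exact: leq_trans (inv_lev_le inv v) (leq_trans top_le_nv nv_le_fuel). Qed.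

Lemma far_endTE e : far_endT k (enc_state st) (item st e) = enc_far st e (far_end st e).
Proof.
rewrite /far_endT /far_end /enc_state /item [tree_hd (Node _ _)]/= [tree_tl (Node _ _)]/=.
have prioE a s : prioT (enc_nat a) (enc_bool s) =
    enc_nat (if a == 0 then ~~ s : nat else a.+1) by case: a s => [|a] [].
have top_le : top st <= fuel k := leq_trans top_le_nv nv_le_fuel.
rewrite /= !nthT_enum ?nv_le_fuel // !eqT_nat ?lev_le_fuel // !is_node_bool.
by case: (e \in sol st) => //; case: eqP => // _; case: eqP => // _; rewrite /= prioE.
Qed.

Definition better (b : option (E * V)) (e : E) : option (E * V) :=
  if far_end st e is Some w then
    if b is Some (e0, w0) then
      if prio st e0 w0 <= prio st e w then b else Some (e, w)
    else Some (e, w)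
  else b.

Definition enc_best (b : option (E * V)) : tree :=
  if b is Some (e, w) then Node (enc_nat (prio st e w)) (Node (enc_nat e) (enc_nat w)) else Leaf.

Lemma prio_le_fuel e w : far_end st e = Some w -> prio st e w <= fuel k.
Proof.
move=> /eqP/far_endP[u [_ _ lu lw]]; rewrite /prio fuel_enc.
have := nv_le_fuel; rewrite fuel_enc => h.
case: ifP => _; first by case: (_ \notin _).
(* The far end is below the top level, so the successor of its level is at most [top st]. *)
by have := inv_lev_le inv w; have := top_le_nv; lia.
Qed.

Lemma betterTE b e :
  betterT k (enc_far st e (far_end st e)) (enc_nat e) (enc_best b) = enc_best (better b e).
Proof.
rewrite /betterT /better; case E: (far_end st e) => [w|] //=.
case: b => [[e0 w0]|] //=; rewrite leqT_nat ?prio_le_fuel // is_node_bool.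
by case: ifP.
Qed.

Lemma bestTE : bestT k (enc_state st) = enc_best (foldl better None (enum E)).
Proof.
rewrite /bestT /= !zipT_enum ?ne_le_fuel // lst_enc_seq; last first.
  by rewrite size_map size_enum_ord ne_le_fuel.
(* The loop counter agrees with the edge numbers because [s] is a segment of consecutive edges from
   number [i] on. *)
have Ebest s i b : map val s = iota i (size s) ->
    foldl (fun acc it => Node (Node Leaf (tree_hd acc))
       (betterT k (far_endT k (enc_state st) it) (tree_hd acc) (tree_tl acc)))
    (Node (enc_nat i) (enc_best b)) [seq item st e | e <- s]
    = Node (enc_nat (i + size s)) (enc_best (foldl better b s)).
  elim: s i b => [|e s IH] i b /=; first by rewrite addn0.
  move=> [ei es]; rewrite far_endTE -ei betterTE -[Node Leaf _]/(enc_nat e.+1).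
  by rewrite IH ?es ?ei // addSnnS.
rewrite -[Leaf in Node Leaf Leaf]/(enc_nat 0) -[X in Node _ X]/(enc_best None) Ebest //.
by rewrite size_enum_ord val_enum_ord.
Qed.

Lemma foldl_betterP (s : seq E) (b : option (E * V)) :
  (forall e w, b = Some (e, w) -> far_end st e = Some w) ->
  if foldl better b s is Some (e, w) then
    [/\ far_end st e = Some w,
        forall e' w', e' \in s -> far_end st e' = Some w' -> prio st e w <= prio st e' w'
      & forall e0 w0, b = Some (e0, w0) -> prio st e w <= prio st e0 w0]
  else b = None /\ forall e, e \in s -> far_end st e = None.
Proof.
elim: s b => [|e s IH] b hb /=.
  by case: b hb => [[e0 w0]|] // hb; split=> // [|e1 w1 [-> ->]] //; exact: hb.
have hb' e1 w1 : better b e = Some (e1, w1) -> far_end st e1 = Some w1.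
  rewrite /better; case fe: (far_end st e) => [w|]; last exact: hb.
  case: b hb => [[e0 w0]|] hb; last by case=> <- <-.
  by case: ifP => _; [exact: hb | case=> <- <-].
have := IH _ hb'; case: (foldl _ _ _) => [[e1 w1] [fe mn le]|[b0 none]].
  split=> // [e' w'|e0 w0 b0].
  - rewrite inE => /predU1P[->|]; last exact: mn.
    move=> fe'; move: le; rewrite /better fe'; case: (b) => [[e0 w0]|]; last exact.
    by case: leqP => [h1 /(_ _ _ erefl) h2|_ le]; [apply: leq_trans h2 h1|apply: le].
  - move: le; rewrite /better b0; case: (far_end st e) => [w|]; last exact.
    by case: leqP => [_ le|h1 /(_ _ _ erefl) h2]; [apply: le|apply: leq_trans h2 (ltnW h1)].
move: b0; rewrite /better; case fe: (far_end st e) => [w|].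
  by case: (b) => [[e0 w0]|] //; case: ifP.
by move=> ->; split=> // e'; rewrite inE => /predU1P[->|] //; exact: none.
Qed.

Lemma use_edgeTE e w : far_end st e = Some w ->
  use_edgeT k (enc_state st) (enc_best (Some (e, w))) = enc_state (use_edge st e w).
Proof.
move=> fe; have lw := lev_le_fuel w.
have solE : set_nthT k (enc_set (sol st)) (enc_nat e) (Node Leaf Leaf) = enc_set (e |: sol st).
  rewrite set_nthT_enum ?ne_le_fuel //; congr (enc_seq _); apply: eq_map => e'.
  by rewrite in_setU1; case: eqP.
have levE t : set_nthT k (enc_seq [seq enc_nat (lev st v) | v <- enum V]) (enc_nat w) (enc_nat t)
    = enc_seq [seq enc_nat (if v == w then t else lev st v) | v <- enum V].
  by rewrite set_nthT_enum ?nv_le_fuel //; congr (enc_seq _); apply: eq_map => v; case: eqP.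
rewrite /use_edgeT /use_edge /= solE /prio.
have [lw0|lw0] := eqVneq (lev st w) 0.
  case: (e \in safe I) => /=; first by rewrite levE.
  by rewrite -[Node Leaf _]/(enc_nat (top st).+1) levE.
by rewrite /= is_node_nat lt0n lw0 capT_enum ?nv_le_fuel.
Qed.

Lemma stepTE : exists2 st', stepT k (enc_state st) = enc_state st' & next_state st st'.
Proof.
have none_ok e w : None = Some (e, w) :> option (E * V) -> far_end st e = Some w by [].
rewrite /stepT bestTE; have := foldl_betterP (enum E) none_ok.
case: (foldl _ _ _) => [[e w] [fe mn _]|[_ none]].
  exists (use_edge st e w); first by rewrite use_edgeTE.
  by left; exists e, w; split=> // e' w'; apply: mn; rewrite mem_enum.
by exists st => //; right; split=> // e; apply: none; rewrite mem_enum.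
Qed.

End StepTree.

Lemma startTE : startT k = enc_state (start_state I).
Proof.
rewrite /startT /enc_state /=; congr Node; last first.
  congr Node; rewrite lst_enc_seq; last by rewrite size_map size_enum_ord ne_le_fuel.
  by rewrite /enc_set; elim: (enum E) => //= e s ->; rewrite inE.
have n0 := nv_gt0 G; rewrite enc_natE.
have -> : Node (Node Leaf Leaf) (tree_tl (enc_seq (nseq (nv G) Leaf))) =
    enc_seq (Node Leaf Leaf :: nseq (nv G).-1 Leaf) by case: (nv G) n0.
congr (enc_seq _); apply: (@eq_from_nth _ Leaf).
  by rewrite /= size_map size_enum_ord size_nseq prednK.
move=> i; rewrite /= size_nseq prednK // => hi.
rewrite (nth_map (Ordinal n0)) ?size_enum_ord // nth_enum_ord //.
by case: i hi => //= i hi; rewrite nth_nseq if_same.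
Qed.

(** A feasible [X] keeps the run from getting stuck before [remaining] is 0. *)
Lemma pathTE (X : {set E}) : fgc_feasible X ->
  exists F : {set E}, [/\ pathT k = enc_set F, fgc_feasible F
    & forall Y : {set E}, fgc_feasible Y -> 2 * #|F| + #|Y :&: safe I| <= 3 * #|Y|].
Proof.
move=> fX.
have run (s : seq tree) st q : path_invariant st q -> exists st' q',
    [/\ foldl (fun st _ => stepT k (stepT k st)) (enc_state st) s = enc_state st',
        path_invariant st' q' & remaining st' <= remaining st - 2 * size s].
  elim: s st q => [|t s IH] st q inv /=; first by exists st, q; rewrite muln0 subn0.
  have [st1 -> n1] := stepTE inv; have [q1 inv1 r1] := next_state_invariant inv fX n1.
  have [st2 -> n2] := stepTE inv1; have [q2 inv2 r2] := next_state_invariant inv1 fX n2.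
  have [st3 [q3 [-> inv3 r3]]] := IH _ _ inv2.
  by exists st3, q3; split=> //; move: r1 r2 r3; clear; lia.
have [st [q [E inv r]]] := run (lst k (tree_hd k)) _ _ (start_invariant I).
have r0 : remaining st = 0.
  have := remaining_start I; have := nv_le_fuel; move: r.
  have -> : size (lst k (tree_hd k)) = fuel k by rewrite /lst take_size.
  by clear; lia.
exists (sol st); have [fF le] := remaining0_feasible inv r0.
by split=> //; rewrite /pathT startTE E.
Qed.

End PathTree.

(** * Doubling the safe edges *)

Section Doubling.

Variable I : fgc_instance.
Local Notation G := (fgc_graph I).
Local Notation E := 'I_(ne G).
Local Notation S := (safe I).

(** Copies of an edge are adjacent, so a solution can be translated back in a single scan. *)
Definition double_seq (es : seq E) : seq E :=
  flatten [seq nseq (e \in S).+1 e | e <- es].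

Definition doubled_edges : seq E := double_seq (enum E).

Definition original (i : 'I_(size doubled_edges)) : E := tnth (in_tuple doubled_edges) i.

Definition doubled : multigraph :=
  @Multigraph (nv G) (size doubled_edges) (fun i => ends (original i)) (nv_gt0 G)
    (fun i => no_loop (original i)).

Lemma card_copies e : #|[set i | original i == e]| = (e \in S).+1.
Proof.
have -> : #|[set i | original i == e]| = count_mem e doubled_edges.
  rewrite -sum1_card -sum1_count [in RHS]big_tnth.
  by apply: eq_bigl => i; rewrite inE.
rewrite count_flatten -map_comp sumnE big_map big_enum (bigD1 e) //=.
rewrite big1 ?addn0 => [|e' /negPf ne]; first by rewrite count_nseq /= eqxx; case: (e \in S).
by rewrite count_nseq /= ne.
Qed.

Lemma original_unsafe_inj i j : original i \notin S -> original i = original j -> i = j.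
Proof.
move=> ns eij; have /eqP/cards1P[x hx] : #|[set i' | original i' == original i]| = 1.
  by rewrite card_copies (negPf ns).
have : i \in [set x] by rewrite -hx inE.
have : j \in [set x] by rewrite -hx inE eij.
by rewrite !inE => /eqP-> /eqP->.
Qed.

Lemma other_copy_ex e i : original i != e \/ e \in S -> exists2 j, j != i & original j = e.
Proof.
move=> h; have /card_gt0P[j] : 0 < #|[set i' | original i' == e] :\ i|.
  have := cardsD1 i [set i' | original i' == e]; rewrite card_copies inE.
  by case: h => [/negPf->|->]; lia.
by rewrite !inE => /andP[ji /eqP]; exists j.
Qed.

Lemma connected_original (H : {set 'I_(ne doubled)}) (F : {set E}) :
  (forall i, i \in H -> original i \in F) -> connected H -> connected F.
Proof.
move=> HF /connectedP cH; apply/connectedP => u v.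
apply: connect_sub (cH u v) => x y /adjP[i iH j].
by apply: (connect_edge (HF i iH)).
Qed.

Lemma connected_doubled (H : {set 'I_(ne doubled)}) (F : {set E}) :
  (forall e, e \in F -> exists2 i, i \in H & original i = e) -> connected F -> connected H.
Proof.
move=> FH /connectedP cF; apply/connectedP => u v.
apply: connect_sub (cF u v) => x y /adjP[e /FH[i iH <-] j].
by apply: (connect_edge (G := doubled) iH).
Qed.

(** Take all copies of edges of [X]. Deleting a copy of a safe edge leaves its twin, and deleting
    the copy of an unsafe edge [e] leaves all copies of [X :\ e], which is connected. *)
Lemma doubled_solution (X : {set E}) : fgc_feasible X ->
  exists2 H : {set 'I_(ne doubled)}, two_edge_connected H & #|H| = #|X| + #|X :&: S|.
Proof.
move=> /andP[cX /forall_inP X2]; exists [set i | original i \in X].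
  apply/andP; split.
    apply: connected_doubled cX => e eX.
    have /card_gt0P[i] : 0 < #|[set i | original i == e]| by rewrite card_copies.
    by rewrite inE => /eqP oi; exists i; rewrite ?inE oi.
  apply/forall_inP => i; rewrite inE => iX.
  have [iS|iS] := boolP (original i \in S).
    apply: connected_doubled cX => e eX; have [|j ji oj] := @other_copy_ex e i.
      by have [<-|ne] := eqVneq (original i) e; [right|left].
    by exists j; rewrite // !inE ji oj.
  have cXi : connected (X :\ original i) by apply: X2; rewrite inE iX inE.
  apply: connected_doubled cXi => e; rewrite !inE => /andP[ne eX].
  have [|j ji oj] := @other_copy_ex e i; first by left; rewrite eq_sym.
  by exists j; rewrite // !inE ji oj.
rewrite -sum1_card (partition_big original (mem X)) /=; last by move=> i; rewrite inE.
rewrite (eq_bigr (fun e => 1 + (e \in S))) => [|e eX].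
  rewrite big_split /= sum1_card -big_mkcondr /= sum1_card; congr addn.
  by apply: eq_card => e; rewrite inE.
rewrite -[RHS]/((e \in S).+1) -card_copies -sum1_card; apply: eq_bigl => i.
by rewrite !inE; case: eqP => [->|]; rewrite ?andbF // eX.
Qed.

(** An unsafe edge has only one copy, so deleting it from the image corresponds to deleting that
    copy from [H]. *)
Lemma original_feasible (H : {set 'I_(ne doubled)}) :
  two_edge_connected H -> fgc_feasible (original @: H).
Proof.
move=> /andP[cH /forall_inP H2]; apply/andP; split.
  by apply: connected_original cH => i iH; rewrite imset_f.
apply/forall_inP => e /setIP[/imsetP[i iH ->]]; rewrite inE => ns.
apply: connected_original (H2 i iH) => j; rewrite !inE => /andP[ji jH].
by rewrite imset_f // andbT; apply: contraNneq ji => /esym/(original_unsafe_inj ns) ->.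
Qed.

End Doubling.

(** * Doubling and its inverse on trees *)

Definition doubleT (k : tree) : tree :=
  Node (tree_hd (tree_hd k))
    (foldr (fun it out =>
              Node (tree_hd it) (if is_node (tree_tl it) then Node (tree_hd it) out else out))
       Leaf (lst k (zipT k (tree_tl (tree_hd k)) (tree_tl k)))).

(* Consumes the bits of a solution singly or in pairs, according to the safe
   edges. *)
Definition undouble_step (acc it : tree) : tree :=
  let h := tree_hd acc in
  Node (if is_node it then tree_tl (tree_tl h) else tree_tl h)
    (Node (if is_node it then
             if is_node (tree_hd h) then tree_hd h else tree_hd (tree_tl h)
           else tree_hd h)
       (tree_tl acc)).

Definition undoubleT (k h : tree) : tree :=
  revT k (tree_tl (foldl undouble_step (Node h Leaf) (lst k (tree_tl k)))).

Definition smallerT (k a b : tree) : tree :=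
  if is_node (leqT k (countT k a) (countT k b)) then a else b.

Lemma ptime_doubleT : ptime (fun k x => doubleT k).
Proof. by rewrite /doubleT; ptime_auto. Qed.

Lemma ptime_smallerT : ptime (fun k h => smallerT k (undoubleT k h) (pathT k)).
Proof.
have hs : ptime (fun k x => smallerT k (tree_hd x) (tree_tl x)).
  by rewrite /smallerT; ptime_auto.
have hu : ptime undoubleT by rewrite /undoubleT /undouble_step /=; ptime_auto.
exact: (ptime_comp hs (ptime_node hu ptime_pathT)).
Qed.

Lemma has_zip_mem (T : eqType) (s : seq T) (h : seq bool) e :
  has (fun p => (p.1 == e) && p.2) (zip s h) -> e \in s.
Proof.
elim: s h => [|x s IH] [|b h] //= /orP[/andP[/eqP -> _]|/IH es]; rewrite inE ?eqxx //.
by rewrite es orbT.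
Qed.

Section DoublingTree.

Variable I : fgc_instance.
Local Notation G := (fgc_graph I).
Local Notation E := 'I_(ne G).
Local Notation S := (safe I).
Local Notation k := (enc_fgc I).

Definition enc_edge (e : E) : tree := Node (enc_nat (ends e).1) (enc_nat (ends e).2).

Lemma enc_doubled :
  enc_graph (doubled I) = Node (enc_nat (nv G)) (enc_seq [seq enc_edge e | e <- doubled_edges I]).
Proof.
rewrite /enc_graph /=; congr (Node _ (enc_seq _)).
rewrite -[X in _ = map _ X](map_tnth_enum (in_tuple (doubled_edges I))).
by rewrite -map_comp.
Qed.

Lemma doubleTE : doubleT k = enc_graph (doubled I).
Proof.
rewrite enc_doubled /doubleT /= zipT_enum ?ne_le_fuel // lst_enc_seq; last first.
  by rewrite size_map size_enum_ord ne_le_fuel.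
congr Node; rewrite /doubled_edges; elim: (enum E) => //= e s ->.
by rewrite is_node_bool /double_seq /=; case: (e \in S).
Qed.

(** Used to turn the time bound of the given algorithm, which refers to the doubled graph, into one
    in the original instance. *)
Lemma tree_size_doubled : tree_size (enc_graph (doubled I)) <= 2 * tree_size k.
Proof.
rewrite enc_doubled /=.
suff : tree_size (enc_seq [seq enc_edge e | e <- doubled_edges I]) <=
    2 * tree_size (enc_seq [seq enc_edge e | e <- enum E]).
  rewrite /enc_edge; move: (tree_size (enc_nat _)) (tree_size (enc_seq _)).
  by move=> a b; move: (tree_size _) (tree_size _) => c d; lia.
rewrite /doubled_edges; elim: (enum E) => // e s IH.
rewrite /double_seq /=; case: (e \in S); rewrite /= -/(double_seq s);
  move: IH; move: (tree_size _) (tree_size _) (tree_size _) (tree_size _); lia.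
Qed.

Lemma undoubleTE (H : {set 'I_(ne (doubled I))}) :
  undoubleT k (enc_set H) = enc_set (@original I @: H).
Proof.
(* Some copy of [e] among those of [es] is selected by [hs]. *)
pose bit (es : seq E) (hs : seq bool) (e : E) :=
  has (fun p => (p.1 == e) && p.2) (zip (double_seq es) hs).
have run (es : seq E) hs out : uniq es -> size hs = size (double_seq es) ->
    tree_tl (foldl undouble_step (Node (enc_seq (map enc_bool hs)) out) [seq enc_bool (e \in S) | e <- es])
    = foldl (fun acc it => Node it acc) out [seq enc_bool (bit es hs e) | e <- es].
  elim: es hs out => // e es IH hs out /andP[ne un].
  have nd : e \notin double_seq es.
    by apply: contra ne => /flatten_mapP[e' e'es]; rewrite mem_nseq => /andP[_ /eqP ->].
  have skip hs' : bit es hs' e = false.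
    by apply/negbTE; apply: contra nd => /has_zip_mem.
  have other e' (h : seq bool) : e' \in es -> has (fun p => (p.1 == e') && p.2)
      (zip (nseq (size h) e) h) = false.
    move=> e'es; apply/negbTE; apply: contra ne => /has_zip_mem.
    by rewrite mem_nseq => /andP[_ /eqP <-].
  (* [e] does not recur in [es], so its own bits [h] have no influence on the other edges. *)
  have tail h hs' : size h = (e \in S).+1 ->
      {in es, bit es hs' =1 bit (e :: es) (h ++ hs')}.
    move=> sh e' e'es; rewrite /bit -[double_seq (e :: es)]/(nseq _ e ++ double_seq es) -sh.
    by rewrite zip_cat ?size_nseq // has_cat other.
  rewrite -[double_seq (e :: es)]/(nseq _ e ++ double_seq es) size_cat size_nseq.
  rewrite [foldl _ _ _]/= /undouble_step is_node_bool [foldl _ _ (map _ (e :: es))]/=.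
  case eS: (e \in S) => sz.
    case: hs sz => [|h0 [|h1 hs]] //= [sz]; rewrite is_node_bool.
    have -> : bit (e :: es) [:: h0, h1 & hs] e = h0 || h1.
      by rewrite /bit /double_seq /= eS /= eqxx /= -/(double_seq es) -/(bit es hs e) skip orbF.
    have -> : (if h0 then enc_bool h0 else enc_bool h1) = enc_bool (h0 || h1) by case: h0.
    rewrite IH //; congr foldl; apply/eq_in_map => e' e'es.
    by rewrite (tail [:: h0; h1]) // eS.
  case: hs sz => [|h0 hs] //= [sz].
  have -> : bit (e :: es) (h0 :: hs) e = h0.
    by rewrite /bit /double_seq /= eS /= eqxx /= -/(double_seq es) -/(bit es hs e) skip orbF.
  rewrite IH //; congr foldl; apply/eq_in_map => e' e'es.
  by rewrite (tail [:: h0]) // eS.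
rewrite /undoubleT lst_enc_seq; last by rewrite size_map size_enum_ord ne_le_fuel.
have -> : enc_set H = enc_seq (map enc_bool [seq i \in H | i <- enum 'I_(ne (doubled I))]).
  by rewrite -map_comp.
rewrite run ?enum_uniq //; last by rewrite size_map size_enum_ord.
rewrite foldl_consE revTE lst_enc_seq /= -/(rev _); last first.
  by rewrite size_rev size_map size_enum_ord ne_le_fuel.
rewrite revK; congr (enc_seq _); apply: eq_map => e; congr enc_bool.
rewrite /bit -/(doubled_edges I) -[doubled_edges I as X in zip X _](map_tnth_enum (in_tuple (doubled_edges I))).
rewrite zip_map has_map; apply/hasP/imsetP => [[i _ /= /andP[/eqP <- iH]]|[i iH ->]].
- by exists i.
- by exists i; rewrite ?mem_enum //= eqxx.
Qed.

End DoublingTree.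

(** * The approximation algorithm *)

(** The given program expects [Leaf] in all variables but 0, which holds its input. *)
Fixpoint clear_vars (n : nat) : cmd :=
  if n is n'.+1 then Cseq (Cassign n Eleaf) (clear_vars n') else Cskip.

Lemma runs_clear_vars n s :
  runs (clear_vars n) s n.+1 (fun s' => forall y, s' y = if 0 < y <= n then Leaf else s y).
Proof.
elim: n s => [|n IH] s /=; first by apply: runs_skip => -[|y].
rewrite -[n.+2]add1n; apply: runs_seq; apply: runs_assign.
apply: runs_weaken (IH _) _ _ => // s' hs' y; rewrite hs' /update /=.
by case: eqP => [->|yn]; rewrite ?ltnn ?leqnn ?andbF //; case: ifP; case: ifP => //; lia.
Qed.

(** Variable [M] keeps the instance while [c1] doubles it and [c] solves the doubled one; [c2] then
    gets the instance in 0 and the solution in 1. *)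
Definition fgc_cmd (M : nat) (c1 c c2 : cmd) : cmd :=
  Cseq (Cassign M (Evar 0)) (Cseq c1 (Cseq (Cassign 0 (Evar 1)) (Cseq (clear_vars M.-1)
    (Cseq c (Cseq (Cassign 1 (Evar 0)) (Cseq (Cassign 0 (Evar M))
      (Cseq c2 (Cassign 0 (Evar 1))))))))).

Lemma fgc_cmd_runs c T : poly_le T ->
  exists P B, poly_le B /\ forall I : fgc_instance, forall t s,
    exec c (init_store (enc_graph (doubled I))) t s -> t <= T (enc_fgc I) ->
    runs P (init_store (enc_fgc I)) (B (enc_fgc I))
      (fun s' => s' 0 = smallerT (enc_fgc I) (undoubleT (enc_fgc I) (s 0)) (pathT (enc_fgc I))).
Proof.
move=> pT; have [c1 [b1 [p1 h1]]] := ptime_doubleT.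
have [c2 [b2 [p2 h2]]] := ptime_smallerT.
set M := maxn 2 (maxn (cmd_bound c1) (cmd_bound c)).
have M2 : 2 <= M by rewrite /M; lia.
have M1 : cmd_bound c1 <= M by rewrite /M; lia.
have Mc : cmd_bound c <= M by rewrite /M; lia.
clearbody M.
exists (fgc_cmd M c1 c c2).
exists (fun k => 1 + (b1 k + (1 + (M.-1.+1 + (T k + (1 + (1 + (b2 k + 1)))))))); split.
  by do ![apply: poly_leD | apply: poly_le_cst | by []].
move=> I t s xc tT; set k := enc_fgc I.
apply: runs_seq; apply: runs_assign; apply: runs_seq.
set s0 := update _ _ _.
have s00 : s0 0 = k by rewrite /s0 update_ne //; lia.
apply: runs_weaken (runs_frame (h1 k s0 s00)) _ _ => // s1 [[s10 s11] fr1].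
apply: runs_seq; apply: runs_assign; apply: runs_seq.
apply: runs_weaken (runs_clear_vars _ _) _ _ => // s2 hs2.
have s2M : s2 M = k.
  rewrite hs2; have -> : (0 < M <= M.-1) = false by lia.
  by rewrite update_ne ?fr1 ?/s0 ?update_eq //; lia.
have ag : agree M (init_store (enc_graph (doubled I))) s2.
  move=> y yM; rewrite hs2 /init_store /update /= s11 doubleTE.
  by case: y yM => [|y] yM //=; have -> : y < M.-1 by lia.
have [s3 x3 ag3] := exec_agree xc Mc ag.
apply: runs_seq; exists t, s3; split=> //.
have s3M : s3 M = k by rewrite (exec_frame x3).
have s30 : s3 0 = s 0 by rewrite -ag3 //; lia.
apply: runs_seq; apply: runs_assign; apply: runs_seq; apply: runs_assign => /=.
rewrite update_ne; last by lia.
apply: runs_seq; set s4 := update _ 0 _.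
have s40 : s4 0 = k by rewrite /s4 update_eq.
apply: runs_weaken (h2 k s4 s40) _ _ => // s5 [_ s51].
by apply: runs_assign; rewrite update_eq /= s51 /s4 update_ne // update_eq s30.
Qed.

(** * The approximation ratio *)

Local Open Scope ring_scope.

Lemma opt_exists (P : min_problem) (x : instance P) :
  feasible_instance x -> exists k, is_opt x k.
Proof.
move=> [F fF].
have ex : exists k, [exists F : {set 'I_(ground x)}, feasible F && (#|F| == k)].
  by exists #|F|; apply/existsP; exists F; rewrite fF /=.
have [k /existsP[F' /andP[fF' /eqP cF']] mn] := ex_minnP ex.
exists k; split; first by exists F'.
by move=> F1 fF1; apply: mn; apply/existsP; exists F1; rewrite fF1 /=.
Qed.

(** Weighting [b] by [2 * alpha] cancels [s]: [a + 2 * alpha * b <= alpha * (k + s) + alpha * (3 * k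
    - s) = 4 * alpha * k], while the left side is at least [(2 * alpha + 1) * m]. *)
Lemma weighted_min (R : realFieldType) (alpha a b k s m : R) :
  1 <= alpha -> a <= alpha * (k + s) -> 2 * b + s <= 3 * k -> m <= a -> m <= b ->
  m <= 4 * alpha / (2 * alpha + 1) * k.
Proof.
move=> al ha hb ma mb.
have d0 : 0 < 2 * alpha + 1 by lra.
rewrite mulrAC ler_pdivlMr //.
have h1 : alpha * (2 * m + s) <= alpha * (3 * k) by rewrite ler_pM2l; lra.
lra.
Qed.

Theorem theorem7 (R : realType) (alpha : R) (alpha_ge1 : 1 <= alpha) :
  has_polytime_approx two_ecss alpha ->
  has_polytime_approx fgc (4 * alpha / (2 * alpha + 1)).
Proof.
move=> [c [a [d hc]]].
pose T k := (a * (2 * tree_size k) ^ d + a)%N.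
have pT : poly_le T.
  apply: poly_leD (poly_le_cst a); apply: poly_leM (poly_le_cst a) _; apply: poly_le_exp.
  by exists 2%N, 1%N => k; rewrite expn1.
have timeT I t : (t <= a * tree_size (enc_graph (doubled I)) ^ d + a)%N -> (t <= T (enc_fgc I))%N.
  move=> h; apply: leq_trans h _; rewrite leq_add2r leq_mul2l.
  apply/orP; right; case: (d) => // d'; rewrite leq_exp2r //; exact: tree_size_doubled.
have [P [B [[a' [d' hB]] runP]]] := fgc_cmd_runs c pT.
exists P, a', d' => I.
(* The doubled graph need not be 2-edge connected at this point; the time bound holds on all
   instances. *)
have [t [s [xc tc sc]]] := hc (doubled I).
have [t' [s' [x' le' s'0]]] := runP I t s xc (timeT _ _ tc).
exists t', s'; split=> //; first by rewrite (leq_trans le') // (leq_trans (hB _)) // leq_addr.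
move=> fI; have [opt [[X fX cX] mnX]] := opt_exists fI.
have [H0 fH0 cH0] := doubled_solution fX.
have fD : @feasible_instance two_ecss (doubled I) by exists H0.
have [H sH [fH apH]] := sc fD.
have [optD oD] := opt_exists fD.
(* The optimum of the doubled graph is at most [#|H0|], that is, [#|X| + #|X :&: safe I|]. *)
have leH : #|H|%:R <= alpha * (#|X|%:R + #|X :&: safe I|%:R).
  rewrite -natrD -cH0; apply: le_trans (apH _ oD) _.
  rewrite ler_wpM2l ?ler_nat //; first by lra.
  exact: (oD.2 _ fH0).
have [F [pF fF leF]] := pathTE fX.
set A := @original I @: H.
have fA : fgc_feasible A := original_feasible fH.
have leA : #|A|%:R <= alpha * (#|X|%:R + #|X :&: safe I|%:R).
  by apply: le_trans leH; rewrite ler_nat leq_imset_card.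
have leF' : 2 * #|F|%:R + #|X :&: safe I|%:R <= 3 * #|X|%:R :> R.
  by have := leF X fX; rewrite -(ler_nat R) natrD !natrM.
(* All optimal solutions have the size of [X], so the guarantee can be checked against [X]. *)
have optE k' : @is_opt fgc I k' -> k' = #|X|.
  move=> [[Y fY <-] mnY].
  have le1 : (#|Y| <= #|X|)%N := mnY X fX.
  have le2 : (opt <= #|Y|)%N := mnX Y fY.
  by apply/eqP; rewrite eqn_leq le1 cX le2.
have cardE : smallerT (enc_fgc I) (enc_set A) (enc_set F) =
    if (#|A| <= #|F|)%N then enc_set A else enc_set F.
  rewrite /smallerT !countT_set ?ne_le_fuel // leqT_nat ?is_node_bool //.
  by apply: leq_trans (ne_le_fuel I); have := max_card (mem F); rewrite card_ord.
rewrite s'0 sH undoubleTE pF cardE.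
have [AF|/ltnW FA] := leqP #|A| #|F|.
- exists A; first exact: erefl.
  split=> [|k' /optE ->]; first exact: fA.
  by apply: weighted_min alpha_ge1 leA leF' _ _; rewrite ler_nat.
- exists F; first exact: erefl.
  split=> [|k' /optE ->]; first exact: fF.
  by apply: weighted_min alpha_ge1 leA leF' _ _; rewrite ler_nat.
Qed.
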